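(* There is an absolute constant $C>0$ such that the following holds. Let $p\ge 3$ be a prime. Then there is $\delta_p>0$ such that for every probability distribution $\mu$ on $\mathbb{F}_p$ supported on more than one value the following holds: if, for each $n$, $A\in\mathbb{F}_p^{n\times n}$ is a random matrix with independent $\mu$-distributed entries, then for every $z\in\mathbb{F}_p$, \[\limsup_{n\to\infty}\Pr[\operatorname{per}(A)=z]\le \alpha_p-\delta_p\] and \[\frac1p-\frac{C}{p^3}\le\liminf_{n\to\infty}\Pr[\operatorname{per}(A)=z]\le\limsup_{n\to\infty}\Pr[\operatorname{per}(A)=z]\le\frac1p+\frac{C}{p^3}.\]
   Context: For an $n\times n$ matrix $A=(a_{i,j})$, the permanent is $\operatorname{per}(A)=\sum_{\pi\in S_n}\prod_{i=1}^n a_{i,\pi(i)}$. For a prime power $q$, $\alpha_q=1-\prod_{i=1}^{\infty}(1-q^{-i})$. *)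

(* Defs.v *)
From HB Require Import structures.
From mathcomp Require Import all_boot all_order all_algebra all_fingroup.
From mathcomp Require Import all_classical all_reals all_analysis.

Set Implicit Arguments.
Unset Strict Implicit.
Unset Printing Implicit Defensive.

Import Order.TTheory GRing.Theory Num.Theory.
Import numFieldNormedType.Exports.

Local Open Scope classical_set_scope.
Local Open Scope ring_scope.

Definition permanent (K : comPzRingType) (n : nat) (A : 'M[K]_n) : K :=
  \sum_(s : 'S_n) \prod_(i < n) A i (s i).

Definition alpha (R : realType) (q : nat) : R :=
  1 - limn (fun n : nat => \prod_(1 <= i < n.+1) (1 - q%:R ^- i) : R).

Definition is_distribution (R : realType) (E : finType) (mu : E -> R) : Prop :=
  (forall a, 0 <= mu a) /\ \sum_a mu a = 1.

(* [E] carries the discrete sigma-algebra, so every [B : set E] is an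
   admissible event for a variable with values in [E]. *)
Definition discrete_RV (d : measure_display) (T : measurableType d)
    (E : finType) (X : T -> E) : Prop :=
  forall B : set E, measurable (X @^-1` B).

Definition has_distribution (R : realType) (d : measure_display)
    (T : measurableType d) (P : probability T R) (E : finType)
    (X : T -> E) (mu : E -> R) : Prop :=
  forall a : E, P (X @^-1` [set a]) = (mu a)%:E.

Definition mutually_independent (R : realType) (d : measure_display)
    (T : measurableType d) (P : probability T R) (I E : finType)
    (X : I -> T -> E) : Prop :=
  forall (J : {set I}) (B : I -> set E),
    P (\bigcap_(i in [set` J]) (X i @^-1` B i)) =
    (\prod_(i in J) P (X i @^-1` B i))%E.

Definition iid_random_matrix (R : realType) (d : measure_display)
    (T : measurableType d) (P : probability T R) (K : finType) (n : nat)
    (mu : K -> R) (A : T -> 'M[K]_n) : Prop :=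
  let entry (k : 'I_n * 'I_n) (w : T) : K := A w k.1 k.2 in
  [/\ forall k, discrete_RV (entry k),
      forall k, has_distribution P (entry k) mu
    & mutually_independent P entry].

(* Main.v *)
(* For a random matrix whose first n - t rows are exposed, let c(I), for a set
   I of t columns, be the permanent of these rows on the columns outside I.
   Then c is a symmetric t-tensor vanishing on repeated indices, and exposing
   the next row y contracts it: c'(I) = sum over v outside I of y_v c(I + v).
   Call c robust if many pairwise disjoint I have c(I) <> 0.

   Robustness at a large constant t has probability close to 1: greedily, a
   nonzero subpermanent extends by one column (or one row) unless all the
   fresh entries take prescribed values, and doing this first for the columns
   outside a block of 2t columns and then for the remaining rows yields an
   index set inside that block.  From t + 1 to t, robustness survives up to an
   asymptotic conditional probability of p^-(t+1), because in each of many
   disjoint (t+1)-sets the contraction is controlled by t + 1 linear forms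
   with diagonal coefficient matrix.  At t = 1 the permanent is a linear form
   in the last row with many nonzero coefficients, hence nearly uniform.

   The gain over the determinant comes from t = 2, where the tensor is a
   symmetric matrix with zero diagonal.  In odd characteristic three indices
   with nonzero mutual entries give an invertible 3 x 3 block, so that the next
   contraction degenerates with probability about p^-3 instead of p^-2, and
   such triples occur with positive probability (at least 1 - 3/p - O(1/p^3)).

   Entries need not be uniform.  Given many disjoint blocks of coordinates and,
   for each block, a vector-valued linear map that is invertible on it, the
   coordinates with the same coefficient vector are grouped.  The sum over a
   large group is nearly uniform, so conditionally on the few coordinates in
   small groups the value is nearly uniform on an affine subspace; a favourable
   affine subspace can be reached from the block itself, and among many nearly
   independent blocks some block reaches one. *)

Require Import Defs.
From mathcomp Require Import all_boot all_order all_algebra all_fingroup.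
From mathcomp Require Import all_classical all_reals all_analysis.
From mathcomp Require Import ring lra zify.

Set Implicit Arguments.
Unset Strict Implicit.
Unset Printing Implicit Defensive.

Import Order.TTheory GRing.Theory Num.Theory.
Import numFieldNormedType.Exports.

Local Open Scope ring_scope.

(** * Finite product measures *)

Section ProductExpectation.
Variables (R : realType) (F : finType) (mu : F -> R).

Definition weight (X : finType) (x : {ffun X -> F}) : R := \prod_i mu (x i).

Definition Ex (X : finType) (f : {ffun X -> F} -> R) : R :=
  \sum_x weight x * f x.

Definition Pr (X : finType) (E : {ffun X -> F} -> Prop) : R :=
  Ex (fun x => `[< E x >]%:R).

(** Conditioning is expressed by resampling: for fixed [x], the event [fun y => B (splice Z x y)] is
    [B] conditioned on the coordinates of [x] outside [Z]. *)
Definition splice (X : finType) (Z : {set X}) (x y : {ffun X -> F}) :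
    {ffun X -> F} :=
  [ffun i => if i \in Z then y i else x i].

Hypothesis mu_ge0 : forall a, 0 <= mu a.
Hypothesis mu_sum1 : \sum_a mu a = 1.

Variable X : finType.
Implicit Types (x y : {ffun X -> F}) (f g : {ffun X -> F} -> R).
Implicit Types (A B E : {ffun X -> F} -> Prop) (Z : {set X}).

Lemma weight_ge0 x : 0 <= weight x.
Proof. by apply: prodr_ge0. Qed.

Lemma Ex_prod (h : X -> F -> R) :
  Ex (fun x => \prod_i h i (x i)) = \prod_i \sum_a mu a * h i a.
Proof.
rewrite bigA_distr_bigA /=; apply: eq_bigr => x _.
by rewrite -big_split.
Qed.

Lemma weight_sum1 : \sum_(x : {ffun X -> F}) weight x = 1.
Proof.
transitivity (Ex (fun x => \prod_(i : X) (1 : R))).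
  by apply: eq_bigr => x _; rewrite big1 ?mulr1.
rewrite (Ex_prod (fun _ _ => 1)) big1 // => i _.
by under eq_bigr do rewrite mulr1.
Qed.

Lemma eq_Ex f g : f =1 g -> Ex f = Ex g.
Proof. by move=> fg; apply: eq_bigr => x _; rewrite fg. Qed.

Lemma Ex_le f g : (forall x, f x <= g x) -> Ex f <= Ex g.
Proof. by move=> fg; apply: ler_sum => x _; rewrite ler_wpM2l ?weight_ge0. Qed.

Lemma Ex_cst (c : R) : Ex (fun _ : {ffun X -> F} => c) = c.
Proof. by rewrite /Ex -mulr_suml weight_sum1 mul1r. Qed.

Lemma ExD f g : Ex (fun x => f x + g x) = Ex f + Ex g.
Proof. by rewrite /Ex -big_split; apply: eq_bigr => x _; rewrite mulrDr. Qed.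

Lemma ExZ (c : R) f : Ex (fun x => c * f x) = c * Ex f.
Proof. by rewrite /Ex mulr_sumr; apply: eq_bigr => x _; rewrite mulrCA. Qed.

Lemma ExN f : Ex (fun x => - f x) = - Ex f.
Proof. by rewrite -mulN1r -ExZ; apply: eq_Ex => x; rewrite mulN1r. Qed.

Lemma Ex_sum (I : finType) (h : I -> {ffun X -> F} -> R) :
  Ex (fun x => \sum_i h i x) = \sum_i Ex (h i).
Proof.
rewrite /Ex exchange_big; apply: eq_bigr => x _.
by rewrite mulr_sumr.
Qed.

Lemma Ex_coord (h : F -> R) (v : X) :
  Ex (fun x => h (x v)) = \sum_a mu a * h a.
Proof.
have := Ex_prod (fun i a => if i == v then h a else 1).
rewrite [RHS](bigD1 v) //= eqxx [X in _ * X]big1 ?mulr1; last first.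
  move=> i /negPf ->; rewrite -[RHS]mu_sum1.
  by apply: eq_bigr => a _; rewrite mulr1.
move=> <-; apply: eq_Ex => x; rewrite (bigD1 v) //= eqxx big1 ?mulr1 //.
by move=> i /negPf ->.
Qed.

(* Exchanging the two samples on [Z] is a weight-preserving involution of the
   pairs [(x, y)]. *)
Lemma Ex_splice Z f : Ex f = Ex (fun x => Ex (fun y => f (splice Z x y))).
Proof.
have wS x y : weight x * weight y = weight (splice Z x y) * weight (splice Z y x).
  rewrite /weight -!big_split; apply: eq_bigr => i _ /=; rewrite !ffunE.
  by case: ifP => //; rewrite mulrC.
pose sw (u : {ffun X -> F} * {ffun X -> F}) := (splice Z u.1 u.2, splice Z u.2 u.1).
have swK : involutive sw.
  move=> [x y]; congr pair; apply/ffunP => i; rewrite !ffunE /=;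
    by case: ifP => iZ; rewrite ?iZ ?ffunE ?iZ //= ffunE iZ.
rewrite /Ex.
transitivity (\sum_(x : {ffun X -> F}) \sum_(y : {ffun X -> F}) weight x * weight y * f x).
  apply: eq_bigr => x _; rewrite -mulr_suml -mulr_sumr weight_sum1 mulr1.
  by [].
transitivity (\sum_(x : {ffun X -> F}) \sum_(y : {ffun X -> F}) weight x * weight y * f (splice Z x y)); last first.
  by apply: eq_bigr => x _; rewrite mulr_sumr; apply: eq_bigr => y _; rewrite mulrA.
rewrite !pair_bigA /= [LHS](reindex_inj (inv_inj swK)).
by apply: eq_bigr => -[x y] _ /=; rewrite -wS.
Qed.

Lemma Pr_ge0 E : 0 <= Pr E.
Proof. by apply: sumr_ge0 => x _; rewrite mulr_ge0 ?weight_ge0. Qed.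

Lemma Pr_le1 E : Pr E <= 1.
Proof. by rewrite -(Ex_cst 1); apply: Ex_le => x; case: asboolP. Qed.

Lemma Pr_le A B : (forall x, A x -> B x) -> Pr A <= Pr B.
Proof.
move=> AB; apply: Ex_le => x; rewrite ler_nat.
by case: asboolP => // /AB Bx; rewrite asboolT.
Qed.

Lemma eq_Pr A B : (forall x, A x <-> B x) -> Pr A = Pr B.
Proof. by move=> AB; apply/le_anti; rewrite !Pr_le // => x /AB. Qed.

Lemma Pr_not E : Pr (fun x => ~ E x) = 1 - Pr E.
Proof.
rewrite -(Ex_cst 1) -ExN -ExD; apply: eq_Ex => x.
by rewrite asbool_neg; case: asboolP; rewrite /= ?subrr ?subr0.
Qed.

Lemma Pr_or A B : Pr (fun x => A x \/ B x) <= Pr A + Pr B.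
Proof.
rewrite -ExD; apply: Ex_le => x; rewrite -natrD ler_nat.
by case: (asboolP (A x)) => [a|a]; case: (asboolP (B x)) => b;
  case: asboolP => //= -[].
Qed.

Lemma Pr_split A B : Pr A = Pr (fun x => A x /\ B x) + Pr (fun x => A x /\ ~ B x).
Proof.
rewrite -ExD; apply: eq_Ex => x; rewrite -natrD; congr (_%:R).
by case: (asboolP (A x)) => a; case: (asboolP (A x /\ B x)) => ab;
  case: (asboolP (A x /\ ~ B x)) => anb; tauto.
Qed.

(** The first hypothesis says that [A] ignores the coordinates in [Z], since splicing [x] back in
    gives the converse implication. The second then bounds a conditional probability of [B]. *)
Lemma Pr_splice_le Z A B (b : R) :
  (forall x y, A (splice Z x y) -> A x) ->
  (forall x, A x -> Pr (fun y => B (splice Z x y)) <= b) ->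
  Pr (fun x => A x /\ B x) <= b * Pr A.
Proof.
move=> AZ AB; rewrite -ExZ {1}/Pr (Ex_splice Z); apply: Ex_le => x.
case: (asboolP (A x)) => [Ax|nAx].
  rewrite mulr1; apply: le_trans (AB x Ax); apply: Pr_le => y; by case.
rewrite mulr0 -(Ex_cst 0); apply: Ex_le => y.
by case: asboolP => // -[/AZ].
Qed.

Lemma Pr_splice_ge Z A B (b : R) :
  (forall x y, A (splice Z x y) -> A x) ->
  (forall x, A x -> Pr (fun y => ~ B (splice Z x y)) <= b) ->
  (1 - b) * Pr A <= Pr (fun x => A x /\ B x).
Proof.
move=> AZ AB; have := Pr_splice_le (B := fun x => ~ B x) AZ AB; rewrite (Pr_split A B); lra.
Qed.

Lemma Pr_box (D : {set X}) (b : X -> F) :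
  Pr (fun y => forall i, i \in D -> y i = b i) = \prod_(i in D) mu (b i).
Proof.
pose h i a : R := if i \in D then (a == b i)%:R else 1.
transitivity (Ex (fun y => \prod_i h i (y i))).
  apply: eq_Ex => y; case: asboolP => [yb|nyb].
    by rewrite big1 // => i _; rewrite /h; case: ifP => // /yb ->; rewrite eqxx.
  have /existsNP[i /not_implyP[iD /eqP yi]] := nyb.
  by rewrite (bigD1 i) //= /h iD (negPf yi) mul0r.
rewrite Ex_prod [RHS]big_mkcond; apply: eq_bigr => i _; rewrite /h.
case: ifP => _; last by under eq_bigr do rewrite mulr1.
rewrite (bigD1 (b i)) //= eqxx mulr1 big1 ?addr0 // => a /negPf ->.
by rewrite mulr0.
Qed.

Lemma Pr_box_le (rho : R) (D : {set X}) (b : X -> F) :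
  (forall a, mu a <= rho) ->
  Pr (fun y => forall i, i \in D -> y i = b i) <= rho ^+ #|D|.
Proof.
move=> mur; rewrite Pr_box -prodr_const; apply: ler_prod => i _.
by rewrite mu_ge0 mur.
Qed.

Lemma Pr_splice_le_all Z B (b : R) :
  (forall x, Pr (fun y => B (splice Z x y)) <= b) -> Pr B <= b.
Proof.
move=> Bb; have Pr1 : Pr (fun _ : {ffun X -> F} => True) = 1.
  by rewrite -[RHS](Ex_cst 1) /Pr; apply: eq_Ex => x; rewrite asboolT.
have -> : Pr B = Pr (fun x => True /\ B x) by apply: eq_Pr; tauto.
rewrite -[b]mulr1 -Pr1; exact: (Pr_splice_le (Z := Z)).
Qed.

(* Markov's inequality for the number of failing events. *)
Lemma Pr_few (I : finType) (E : I -> {ffun X -> F} -> Prop) (b : R) (K : nat) :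
  (forall i, Pr (fun x => ~ E i x) <= b) -> (0 < #|I|)%N ->
  Pr (fun x => (#|[set i | `[< E i x >]]%SET| < K)%N) <= b + K%:R / #|I|%:R.
Proof.
move=> Eb I0; have I0' : 0 < #|I|%:R :> R by rewrite ltr0n.
rewrite -(ler_pM2l I0') mulrDr [_ / _]mulrC mulVKf ?gt_eqF //.
set few := fun x => _.
have : #|I|%:R * Pr few - K%:R <= \sum_i Pr (fun x => ~ E i x).
  rewrite lerBlDr -(Ex_cst K%:R) /Pr -Ex_sum -ExZ -ExD; apply: Ex_le => x.
  rewrite -natr_sum -natrM -natrD ler_nat.
  case: asboolP => [fewx|_]; last by rewrite muln0.
  rewrite muln1 (_ : (\sum_i _ = #|~: [set i | `[< E i x >]]%SET|)%N).
    by rewrite -(cardsC [set i | `[< E i x >]]%SET) addnC leq_add2l ltnW.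
  rewrite -sum1_card [RHS]big_mkcond; apply: eq_bigr => i _.
  by rewrite !inE asbool_neg; case: asboolP.
move=> le1; rewrite -lerBlDr; apply: le_trans le1 _.
apply: (@le_trans _ _ (\sum_(i : I) b)); first exact: ler_sum.
by rewrite sumr_const mulr_natl.
Qed.

(** Used with the transposition of index pairs, to exchange the roles of rows and columns. *)
Lemma Ex_reindex (Y : finType) (g : Y -> X) (f : {ffun Y -> F} -> R) :
  bijective g -> Ex (fun x : {ffun X -> F} => f [ffun y => x (g y)]) = Ex f.
Proof.
move=> [g' gK g'K].
pose G (x : {ffun X -> F}) : {ffun Y -> F} := [ffun y => x (g y)].
have G_bij : bijective G.
  exists (fun z : {ffun Y -> F} => [ffun i => z (g' i)]) => z;
    by apply/ffunP => i; rewrite !ffunE ?gK ?g'K.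
rewrite /Ex [RHS](reindex G) /=; last exact: onW_bij.
apply: eq_bigr => x _; congr (_ * _); rewrite /weight (reindex g) /=.
  by apply: eq_bigr => y _; rewrite ffunE.
by apply: onW_bij; exists g'.
Qed.

End ProductExpectation.

Lemma injection_of_card (T : finType) (A : {set T}) (K : nat) : (K <= #|A|)%N ->
  exists f : 'I_K -> T, injective f /\ forall k, f k \in A.
Proof.
move=> KA; exists (fun k => enum_val (widen_ord KA k)); split=> [k k'|k].
  by move=> /enum_val_inj/(congr1 val)/= ?; apply: val_inj.
exact: enum_valP.
Qed.

(** * Subpermanents *)

Section Subpermanent.
Variables (K : comPzRingType) (I J : finType).
Implicit Types (a : I -> J -> K) (rs : seq I) (S : {set J}).

(** Laplace expansion along the rows in the order of the list. Shapes that are not square are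
    allowed and give 0. *)
Fixpoint subper_seq a rs S : K :=
  if rs is r :: rs' then \sum_(j in S) a r j * subper_seq a rs' (S :\ j)
  else (S == finset.set0)%:R.

Lemma eq_subper_seq a b rs S :
  (forall i j, i \in rs -> j \in S -> a i j = b i j) ->
  subper_seq a rs S = subper_seq b rs S.
Proof.
elim: rs S => //= r rs IH S ab; apply: eq_bigr => j jS.
rewrite ab ?mem_head // IH // => i k irs; rewrite !inE => /andP[_ kS].
by rewrite ab // inE irs orbT.
Qed.

(** The order of the rows is immaterial, because two successive row expansions can be exchanged. *)
Lemma subper_seq_rem a rs S r : r \in rs ->
  subper_seq a rs S = \sum_(j in S) a r j * subper_seq a (rem r rs) (S :\ j).
Proof.
elim: rs S => //= r0 rs IH S; rewrite inE eq_sym.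
case: eqP => [-> //|_ /= rrs].
under eq_bigr => i iS do rewrite IH // mulr_sumr.
under [RHS]eq_bigr => i iS do rewrite mulr_sumr.
rewrite (exchange_big_dep (mem S)) /=; last by move=> i j _; rewrite inE => /andP[].
apply: eq_bigr => j jS; apply: eq_big => [i|i /andP[iS iSj]].
  by rewrite !inE jS andbT eq_sym andbC.
by rewrite mulrCA; congr (_ * (_ * subper_seq _ _ _)); apply/setP => k;
  rewrite !inE andbCA.
Qed.

(** In the expansion along the first row, the term of column [v] is the first summand; in all other
    terms [v] is still present and the induction hypothesis applies. *)
Lemma subper_seq_col a rs S v : uniq rs -> v \notin S ->
  subper_seq a rs (v |: S) =
  \sum_(r <- rs) a r v * subper_seq a (rem r rs) S.
Proof.
elim: rs S => [|r0 rs IH] S /=.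
  move=> _ _; rewrite big_nil.
  by have /negPf -> : v |: S != finset.set0 by apply/set0Pn; exists v; rewrite !inE eqxx.
move=> /andP[r0rs urs] vS; rewrite big_setU1 //= setU1K // big_cons eqxx.
congr (_ + _).
under eq_bigr => j jS.
  have vj : v != j by apply: contraNneq vS => ->.
  have -> : (v |: S) :\ j = v |: (S :\ j).
    apply/setP => k; rewrite !inE; case: (eqVneq k v) => [->|_] //=.
    by rewrite vj.
  rewrite IH ?inE ?negb_and ?vS ?orbT // mulr_sumr.
  over.
rewrite exchange_big /=; rewrite !big_seq; apply: eq_bigr => r rrs.
have /negPf r0r : r0 != r by apply: contraNneq r0rs => ->.
by rewrite r0r /= mulr_sumr; apply: eq_bigr => j _; rewrite mulrCA.
Qed.

Definition subper a (A : {set I}) S : K := subper_seq a (enum A) S.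

Lemma rem_enum (A : {set I}) r : rem r (enum A) = enum (A :\ r).
Proof.
rewrite rem_filter ?enum_uniq // /enum_mem -filter_predI.
by apply: eq_filter => i; rewrite !inE.
Qed.

Lemma eq_subper a b (A : {set I}) S :
  (forall i j, i \in A -> j \in S -> a i j = b i j) ->
  subper a A S = subper b A S.
Proof. by move=> ab; apply: eq_subper_seq => i j; rewrite mem_enum; apply: ab. Qed.

Lemma subper0 a : subper a finset.set0 finset.set0 = 1.
Proof. by rewrite /subper enum_set0 /= eqxx. Qed.

Lemma subper_row a (A : {set I}) S r : r \notin A ->
  subper a (r |: A) S = \sum_(j in S) a r j * subper a A (S :\ j).
Proof.
move=> rA; rewrite /subper (@subper_seq_rem _ _ _ r) ?mem_enum ?setU11 //.
by rewrite rem_enum setU1K.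
Qed.

Lemma subper_col a (A : {set I}) S v : v \notin S ->
  subper a A (v |: S) = \sum_(r in A) a r v * subper a (A :\ r) S.
Proof.
move=> vS; rewrite /subper subper_seq_col ?enum_uniq // big_enum /=.
by apply: eq_bigr => r _; rewrite rem_enum.
Qed.

End Subpermanent.

(** Induction on the number of columns: one side is expanded along a column [v], the other along [v]
    as a row. *)
Lemma subper_tr (K : comPzRingType) (I J : finType) (a : I -> J -> K)
    (A : {set I}) (S : {set J}) :
  subper a A S = subper (fun j i => a i j) S A.
Proof.
have [n] := ubnP #|S|; elim: n S A => // n IH S A.
have [->|[v vS]] := set_0Vmem S.
  rewrite {2}/subper enum_set0 /=.
  have [->|[r rA] _] := set_0Vmem A; first by rewrite subper0 eqxx.
  rewrite -(finset.setD1K rA) subper_row ?inE ?eqxx // big_set0.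
  by have /negPf -> : r |: A :\ r != finset.set0 by apply/set0Pn; exists r; rewrite !inE eqxx.
rewrite (cardsD1 v) vS => ltSn.
rewrite -(finset.setD1K vS) subper_col ?subper_row ?inE ?eqxx //.
by apply: eq_bigr => r _; rewrite IH.
Qed.

Lemma permanent_subper (K : comPzRingType) (n : nat) (M : 'M[K]_n) :
  permanent M = subper (fun i j => M i j) finset.setT finset.setT.
Proof.
(* Induction on the rows [rs] still free; the values on [done] are fixed. *)
have gen rs done (g : 'I_n -> 'I_n) : perm_eq (rs ++ done) (enum 'I_n) ->
    {in done &, injective g} ->
  \sum_(s : 'S_n | [forall i in done, s i == g i]) \prod_(i <- rs) M i (s i) =
  subper_seq (fun i j => M i j) rs (~: [set g i | i in done])%SET.
  elim: rs done g => [|r rs IH] done g /= prm gi.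
    have alld i : i \in done by rewrite (perm_mem prm) mem_enum.
    have gI : injective g by move=> i j; apply: gi.
    rewrite (eq_bigl (pred1 (perm gI))) => [|s].
      rewrite big_pred1_eq big_nil; case: eqP => // /eqP/set0Pn[j].
      rewrite inE => /imsetP[]; exists ((perm gI)^-1%g j) => //.
      by rewrite -(permE gI) permKV.
    apply/'forall_implyP/eqP => [sg|-> i _]; last by rewrite permE.
    by apply/permP => i; rewrite permE (eqP (sg i _)).
  have ud : uniq (r :: rs ++ done) by rewrite (perm_uniq prm) enum_uniq.
  have rd : r \notin done.
    by move: ud => /= /andP[]; rewrite mem_cat negb_or => /andP[].
  rewrite (partition_big (fun s : 'S_n => s r)
    (mem (~: [set g i | i in done])%SET)) /=; last first.
    move=> s /'forall_implyP sg; rewrite inE; apply/imsetP => -[i id si].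
    have /perm_inj ri : s r = s i by rewrite si (eqP (sg i id)).
    by rewrite ri id in rd.
  apply: eq_bigr => j; rewrite inE => jg.
  pose g' i := if i == r then j else g i.
  have g'E i : i \in done -> g' i = g i.
    by rewrite /g'; case: eqP => // -> rd'; rewrite rd' in rd.
  have := IH (r :: done) g'.
  have -> : [set g' i | i in r :: done]%SET = (j |: [set g i | i in done])%SET.
    apply/setP => k; rewrite !inE; apply/imsetP/idP => [[i]|/orP[/eqP->|]].
    - rewrite inE => /orP[/eqP ->|id] ->; first by rewrite /g' !eqxx.
      by rewrite g'E // imset_f ?orbT.
    - by exists r; rewrite ?inE ?eqxx // /g' eqxx.
    - by move=> /imsetP[i id ->]; exists i; rewrite ?inE ?id ?orbT ?g'E.
  have -> : (~: (j |: [set g i | i in done]) = ~: [set g i | i in done] :\ j)%SET.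
    by apply/setP => k; rewrite !inE negb_or.
  move=> <-; last 2 first.
  - by apply: perm_trans prm; rewrite perm_catC /= perm_cons perm_catC.
  - move=> i k; rewrite !inE => /orP[/eqP->|id] /orP[/eqP->|kd] //.
    + rewrite {1}/g' eqxx g'E // => jk; case/negP: jg; rewrite jk.
      exact: imset_f.
    + rewrite {2}/g' eqxx g'E // => jk; case/negP: jg; rewrite -jk.
      exact: imset_f.
    + by rewrite !g'E //; apply: gi.
  rewrite mulr_sumr; apply: eq_big => [s|s /andP[_ /eqP <-]]; last first.
    by rewrite big_cons.
  apply/andP/'forall_implyP => [[/'forall_implyP sg /eqP srj] i|sg].
    rewrite inE => /orP[/eqP ->|id]; first by rewrite srj /g' eqxx.
    by rewrite g'E // sg.
  split; last by have := sg r; rewrite inE eqxx /g' eqxx; apply.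
  by apply/'forall_implyP => i id; rewrite -g'E // sg // inE id orbT.
have := gen (enum 'I_n) [::] id; rewrite cats0 => /(_ (perm_refl _)).
rewrite (_ : [set id i | i in [::]]%SET = finset.set0); last first.
  by apply/setP => i; rewrite inE; apply/imsetP => -[].
rewrite finset.setC0 /permanent /subper enumT.
have -> : enum [set: 'I_n]%SET = Finite.enum 'I_n.
  by rewrite -enumT; apply: eq_enum => i; rewrite inE.
move=> <- //; apply: eq_big => [s|s _]; last by rewrite -enumT big_enum.
by apply/esym/'forall_implyP.
Qed.

(** * Equidistribution of sums and linear forms *)

Lemma expr_small (R : realType) (x e : R) :
  0 <= x < 1 -> 0 < e -> exists n : nat, x ^+ n <= e.
Proof.
move=> /andP[x0 x1] e0.
have /cvgrPdist_le/(_ e e0)[n _ /(_ n (leqnn n))] : (x ^+ n @[n --> \oo] --> (0 : R))%classic.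
  by apply: cvg_expr; rewrite ger0_norm.
by rewrite sub0r normrN ger0_norm ?exprn_ge0 // => xn; exists n.
Qed.

Section Equidistribution.
Variables (R : realType) (p : nat) (mu : 'F_p -> R).
Hypothesis p_prime : prime p.
Hypothesis mu_ge0 : forall a, 0 <= mu a.
Hypothesis mu_sum1 : \sum_a mu a = 1.

Let p_gt0 : 0 < p%:R :> R.
Proof. by rewrite ltr0n prime_gt0. Qed.

(** The convolution powers of [mu], that is, the law of a sum of [m] independent samples. *)
Fixpoint conv (m : nat) : 'F_p -> R :=
  if m is m'.+1 then fun a => \sum_b mu b * conv m' (a - b)
  else fun a => (a == 0)%:R.

Lemma conv_sum0 (h : 'F_p -> R) : \sum_a conv 0 a * h a = h 0.
Proof.
rewrite (bigD1 0) //= [X in _ + X]big1 => [|a /negPf ->]; last by rewrite mul0r.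
by rewrite addr0 mul1r.
Qed.

Lemma Ex_sum_coord (X : finType) (W : {set X}) (h : 'F_p -> R) :
  Ex mu (fun y => h (\sum_(v in W) y v)) = \sum_a conv #|W| a * h a.
Proof.
have [n] := ubnP #|W|; elim: n W h => // n IH W h.
have [->|[v vW]] := set_0Vmem W.
  rewrite cards0 conv_sum0 => _.
  by under eq_Ex do rewrite big_set0; rewrite (Ex_cst mu_sum1).
rewrite (cardsD1 v) vW add1n ltnS => ltWn.
rewrite (Ex_splice mu_sum1 [set v]%SET).
transitivity (Ex mu (fun x => \sum_b mu b * h (b + \sum_(i in W :\ v) x i))).
  apply: eq_Ex => x; rewrite -(Ex_coord mu_sum1 (fun b => h (b + _)) v).
  apply: eq_Ex => y; congr h; rewrite (big_setD1 v) //= !ffunE !inE eqxx.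
  congr (_ + _); apply: eq_bigr => i; rewrite !inE ffunE inE => /andP[].
  by move=> /negPf ->.
rewrite (IH _ (fun a => \sum_b mu b * h (b + a))) //=.
under eq_bigr do rewrite mulr_sumr.
under [RHS]eq_bigr do rewrite mulr_suml.
rewrite exchange_big [RHS]exchange_big /=; apply: eq_bigr => b _.
rewrite [RHS](reindex_inj (addrI b)) /=; apply: eq_bigr => a _.
by rewrite addrAC subrr add0r mulrCA mulrA.
Qed.

Lemma conv_ge0 m a : 0 <= conv m a.
Proof.
by elim: m a => [|m IH] a //=; apply: sumr_ge0 => b _; rewrite mulr_ge0.
Qed.

Lemma conv_sum1 m : \sum_a conv m a = 1.
Proof.
elim: m => [|m IH] /=.
  transitivity (\sum_a conv 0 a * 1); last exact: (conv_sum0 (fun=> 1)).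
  by apply: eq_bigr => a _; rewrite mulr1.
rewrite exchange_big -mu_sum1; apply: eq_bigr => b _.
rewrite -mulr_sumr (reindex_inj (addIr b)) /=.
by under eq_bigr do rewrite addrK; rewrite IH mulr1.
Qed.

Lemma convD m k a : conv (m + k) a = \sum_b conv m b * conv k (a - b).
Proof.
elim: m a => [|m IH] a.
  by rewrite (conv_sum0 (fun b => conv k (a - b))) subr0.
rewrite addSn /=.
under eq_bigr do rewrite IH mulr_sumr.
under [RHS]eq_bigr do rewrite mulr_suml.
rewrite [RHS]exchange_big; apply: eq_bigr => b _ /=.
rewrite [RHS](reindex_inj (addrI b)) /=; apply: eq_bigr => c _.
by rewrite mulrA opprD addrA [X in conv m (X - b)]addrC addrK.
Qed.

Lemma conv_lower_mono l m k a :
  (forall b, l <= conv m b) -> l <= conv (k + m) a.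
Proof.
move=> lm; rewrite convD -[l]mul1r -(conv_sum1 k) mulr_suml.
by apply: ler_sum => b _; rewrite ler_wpM2l ?conv_ge0.
Qed.

Variables (u v : 'F_p) (kappa : R).
Hypothesis uv : u != v.
Hypothesis kappa_gt0 : 0 < kappa.
Hypothesis mu_u : kappa <= mu u.
Hypothesis mu_v : kappa <= mu v.

Lemma conv_progression m k : (k <= m)%N ->
  kappa ^+ m <= conv m (u *+ (m - k) + v *+ k).
Proof.
have term m' (b a : 'F_p) : kappa <= mu b -> kappa ^+ m' <= conv m' (a - b) ->
    kappa ^+ m'.+1 <= conv m'.+1 a.
  move=> kb ka /=; rewrite (bigD1 b) //= exprS.
  apply: ler_wpDr; first by apply: sumr_ge0 => c _; rewrite mulr_ge0 ?conv_ge0.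
  by apply: ler_pM => //; [exact: ltW|rewrite exprn_ge0 ?ltW].
elim: m k => [|m IH] k.
  by rewrite leqn0 => /eqP ->; rewrite expr0 subnn !mulr0n addr0 /= lexx.
rewrite leq_eqVlt => /orP[/eqP -> |].
  apply: (term _ v) => //; rewrite subnn mulr0n add0r mulrSr addrK.
  by have := IH m (leqnn m); rewrite subnn mulr0n add0r.
rewrite ltnS => km; apply: (term _ u) => //.
by rewrite subSn // mulrSr addrAC addrK IH.
Qed.

Lemma conv_full a : kappa ^+ p.-1 <= conv p.-1 a.
Proof.
have p0 := prime_gt0 p_prime.
(* The sums of [p - 1] terms from [{u, v}] form the progression [u *+ p.-1 + (v - u) *+ t] with
   [0 <= t < p], which covers the field; this [t] reaches [a]. *)
pose t := (a - u *+ p.-1) / (v - u).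
have vu : v - u != 0 by rewrite subr_eq0 eq_sym.
have tp : ((t : nat) <= p.-1)%N.
  by rewrite -ltnS prednK // -[X in (_ < X)%N](Fp_cast p_prime) ltn_ord.
have := conv_progression tp; congr (_ <= conv _ _).
have -> : u *+ (p.-1 - t) + v *+ t = u *+ p.-1 + (v - u) *+ t.
  by rewrite mulrnBl addrCA -mulrnBr // addrC.
rewrite -[(v - u) *+ t]mulr_natr natr_Zp mulrC divfK //.
by rewrite addrC subrK.
Qed.

(** Doeblin's argument: [conv p.-1] dominates [p * k0] times the uniform law, so the deficit from
    uniformity shrinks by the factor [1 - p * k0] with every further [p - 1] samples. *)
Lemma conv_equidistributed (eta : R) : 0 < eta ->
  exists s, forall m a, (s <= m)%N -> (1 - eta) / p%:R <= conv m a.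
Proof.
move=> eta0; pose k0 := kappa ^+ p.-1.
have k0_gt0 : 0 < k0 by rewrite exprn_gt0.
have pk1 : p%:R * k0 <= 1.
  rewrite -[leRHS](conv_sum1 p.-1); apply: le_trans (ler_sum _ (fun a _ => conv_full a)).
  by rewrite sumr_const card_Fp // mulr_natl.
have [|j ej] := @expr_small R (1 - p%:R * k0) eta _ eta0.
  by rewrite subr_ge0 pk1 /= ltrBlDr ltrDl mulr_gt0.
have lower i a : (1 - (1 - p%:R * k0) ^+ i) / p%:R <= conv (i * p.-1) a.
  elim: i a => [|i IH] a.
    by rewrite expr0 subrr mul0r conv_ge0.
  rewrite mulSn convD; set l := _ / _ in IH.
  have pl : p%:R * l = 1 - (1 - p%:R * k0) ^+ i by rewrite mulrC divfK ?gt_eqF.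
  have sumB : \sum_b conv (i * p.-1) (a - b) = 1.
    rewrite -[RHS](conv_sum1 (i * p.-1)) [RHS](reindex_inj (@inv_inj _ (fun b => a - b) _)) //=.
    by move=> b; rewrite subKr.
  have -> : (1 - (1 - p%:R * k0) ^+ i.+1) / p%:R = l + k0 * (1 - p%:R * l).
    by rewrite exprS pl subKr /l; field; rewrite gt_eqF.
  (* The recursion is the sum over [b] of the inequality that the product of the gaps
     [conv p.-1 b - k0] and [conv (i * p.-1) (a - b) - l] is nonnegative. *)
  have -> : l + k0 * (1 - p%:R * l) = \sum_b (conv p.-1 b * l + k0 * (conv (i * p.-1) (a - b) - l)).
    rewrite big_split /= -mulr_suml conv_sum1 mul1r -mulr_sumr sumrB sumB.
    by rewrite sumr_const card_Fp // mulr_natl.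
  apply: ler_sum => b _.
  rewrite -subr_ge0.
  rewrite (_ : _ - _ = (conv p.-1 b - k0) * (conv (i * p.-1) (a - b) - l)); last by ring.
  by rewrite mulr_ge0 // subr_ge0; [exact: conv_full|exact: IH].
exists (j * p.-1)%N => m a jm; rewrite -(subnK jm); apply: conv_lower_mono => b.
apply: le_trans (lower j b).
by rewrite ler_pM2r ?invr_gt0 // lerD2l lerN2.
Qed.

End Equidistribution.

(** * Averages over uniform combinations of vectors *)

Section Averages.
Variables (R : realType) (p : nat).
Hypothesis p_prime : prime p.
Variable d : nat.
Local Notation V := 'rV['F_p]_d.
Implicit Types (h : V -> R) (ts : seq V) (w t : V).

Let p_gt0 : 0 < p%:R :> R.
Proof. by rewrite ltr0n prime_gt0. Qed.

Let p_neq0 : p%:R != 0 :> R.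
Proof. by rewrite gt_eqF. Qed.

Definition avg1 t h w : R := p%:R^-1 * \sum_a h (w + a *: t).

(* [avg ts h w] is the expectation of [h] at [w] plus a uniformly random
   combination of the vectors in [ts]. *)
Fixpoint avg ts h : V -> R := if ts is t :: ts' then avg1 t (avg ts' h) else h.

Lemma sum_Fp_cst (c : R) : \sum_(a : 'F_p) c = p%:R * c.
Proof. by rewrite sumr_const card_Fp // mulr_natl. Qed.

Lemma avg1_cst t (c : R) w : avg1 t (fun=> c) w = c.
Proof. by rewrite /avg1 sum_Fp_cst mulKf. Qed.

Lemma eq_avg ts h h' w : h =1 h' -> avg ts h w = avg ts h' w.
Proof.
move=> hh; elim: ts w => [|t ts IH] w //=.
by rewrite /avg1; under eq_bigr do rewrite IH.
Qed.

Lemma avg_cst ts (c : R) w : avg ts (fun=> c) w = c.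
Proof.
elim: ts w => [|t ts IH] w //=; rewrite -[RHS](avg1_cst t c w) /avg1.
by under eq_bigr do rewrite IH.
Qed.

Lemma avg_le ts h h' w : (forall v, h v <= h' v) -> avg ts h w <= avg ts h' w.
Proof.
move=> hh; elim: ts w => [|t ts IH] w //=.
by rewrite ler_wpM2l ?invr_ge0 ?ler_sum // ltW.
Qed.

Lemma avg_ge0 ts h w : (forall v, 0 <= h v) -> 0 <= avg ts h w.
Proof. by move=> h0; rewrite -(avg_cst ts 0 w); apply: avg_le. Qed.

Lemma avgD ts h h' w : avg ts (fun v => h v + h' v) w = avg ts h w + avg ts h' w.
Proof.
elim: ts w => [|t ts IH] w //=.
by rewrite /avg1; under eq_bigr do rewrite IH; rewrite big_split mulrDr.
Qed.

Lemma avg_sum (I : finType) (h : I -> V -> R) ts w :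
  avg ts (fun v => \sum_i h i v) w = \sum_i avg ts (h i) w.
Proof.
elim: ts w => [|t ts IH] w //=.
transitivity (p%:R^-1 * \sum_a \sum_i avg ts (h i) (w + a *: t)).
  by congr (_ * _); apply: eq_bigr.
by rewrite exchange_big mulr_sumr.
Qed.

(** Only the term with all coefficients 0 is kept. *)
Lemma avg_ge_self ts h w : (forall v, 0 <= h v) ->
  p%:R^-1 ^+ size ts * h w <= avg ts h w.
Proof.
move=> h0; elim: ts w => [|t ts IH] w /=; first by rewrite mul1r.
rewrite exprS -mulrA ler_wpM2l ?invr_ge0 ?(ltW p_gt0) //.
rewrite (bigD1 0) //= scale0r addr0.
by apply: ler_wpDr => //; apply: sumr_ge0 => a _; apply: avg_ge0.
Qed.

Lemma avg_zero_notin ts w : w \notin <<ts>>%VS ->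
  avg ts (fun v => (v == 0)%:R) w = 0.
Proof.
elim: ts w => [|t ts IH] w /=.
  by rewrite span_nil memv0 => /negPf ->.
rewrite span_cons => wts; rewrite /avg1 big1 ?mulr0 // => a _.
apply: IH; apply: contra wts => wts.
rewrite addvC -[w](addrK (a *: t)) memv_add //.
by rewrite rpredN rpredZ ?memv_line.
Qed.

(** A vector in the span of the later ones leaves the bound unchanged. For a new vector [t], at most
    one coefficient [a] brings [w + a *: t] into that span, which gains a factor [1 / p]. *)
Lemma avg_zero_le ts w :
  avg ts (fun v => (v == 0)%:R) w <= p%:R^-1 ^+ \dim <<ts>>.
Proof.
elim: ts w => [|t ts IH] w /=.
  by rewrite span_nil dimv0 expr0; case: eqP.
have pV0 : 0 <= p%:R^-1 :> R by rewrite invr_ge0 ltW.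
rewrite span_cons; have [tts|tts] := boolP (t \in <<ts>>%VS).
  have /addv_idPr -> : (<[t]> <= <<ts>>)%VS by rewrite -memvE.
  rewrite -[leRHS](avg1_cst t _ w) ler_wpM2l //; apply: ler_sum => a _.
  exact: IH.
have -> : \dim (<[t]> + <<ts>>) = (\dim <<ts>>).+1.
  rewrite dimv_disjoint_sum; last first.
    apply/eqP; rewrite -subv0; apply/subvP => x; rewrite memv_cap memv0.
    move=> /andP[/vlineP[k ->] kts]; apply: contraNT tts => k0.
    have k0' : k != 0 by apply: contraNneq k0 => ->; rewrite scale0r.
    by have := rpredZ k^-1 kts; rewrite scalerA mulVf // scale1r.
  rewrite dim_vline (_ : t != 0) //.
  by apply: contraNneq tts => ->; rewrite mem0v.
rewrite exprS ler_wpM2l //.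
have [[a wa]|none] := pselect (exists a, w + a *: t \in <<ts>>%VS); last first.
  rewrite big1 ?exprn_ge0 // => a _; apply: avg_zero_notin.
  by apply/negP => wa; apply: none; exists a.
rewrite (bigD1 a) //= big1 ?addr0 // => b ba; apply: avg_zero_notin.
apply: contra tts => wb.
have : (b - a) *: t \in <<ts>>%VS.
  by have := rpredB wb wa; rewrite opprD addrACA subrr add0r -scalerBl.
move=> /(rpredZ (b - a)^-1); rewrite scalerA mulVf ?scale1r // subr_eq0 //.
Qed.

(** Either all vectors vanish at [j] and the coordinate keeps its nonzero value, or the coordinate
    becomes exactly uniform. *)
Lemma avg_coord_eq0 ts w j : w 0 j != 0 ->
  avg ts (fun v => (v 0 j == 0)%:R) w <= p%:R^-1.
Proof.
move=> wj.
suff [->|->] : (forall v, avg ts (fun v => (v 0 j == 0)%:R) v = (v 0 j == 0)%:R) \/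
    (forall v, avg ts (fun v => (v 0 j == 0)%:R) v = p%:R^-1).
- by rewrite (negPf wj) invr_ge0 ltW.
- by [].
elim: ts => [|t ts [IH|IH]] /=; first by left.
  have [tj|tj] := eqVneq (t 0 j) 0; [left|right] => v; rewrite /avg1.
    under eq_bigr do rewrite IH !mxE tj mulr0 addr0.
    by rewrite sum_Fp_cst mulKf.
  rewrite (bigD1 (- v 0 j / t 0 j)) //= IH !mxE divfK // subrr eqxx big1 ?addr0 ?mulr1 //.
  move=> a av; rewrite IH !mxE (_ : (_ == 0) = false) //.
  apply: contraNF av => /eqP/(canRL (addKr _)); rewrite addr0 => <-.
  by rewrite mulfK.
right => v; rewrite -[RHS](avg1_cst t _ v) /avg1.
by under eq_bigr do rewrite IH.
Qed.

Lemma avg_all_neq0 ts w : (forall j, w 0 j != 0) ->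
  1 - d%:R / p%:R <= avg ts (fun v => [forall j, v 0 j != 0]%:R) w.
Proof.
move=> wn0.
have : 1 <= avg ts (fun v => [forall j, v 0 j != 0]%:R + \sum_j (v 0 j == 0)%:R) w.
  rewrite -[leLHS](avg_cst ts 1 w); apply: avg_le => v.
  rewrite -natr_sum -natrD ler1n; case: forallP => // nf.
  have [j vj] : exists j, v 0 j == 0.
    by apply: contra_notP nf => nex j; apply/negP => vj; apply: nex; exists j.
  by rewrite (bigD1 j) //= vj addnA addn1.
rewrite avgD avg_sum => le1; rewrite lerBlDr; apply: le_trans le1 _.
rewrite lerD2l; apply: (@le_trans _ _ (\sum_(j < d) p%:R^-1)).
  by apply: ler_sum => j _; apply: avg_coord_eq0.
by rewrite sumr_const card_ord mulr_natl.
Qed.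

Section Minorization.
Variable mu : 'F_p -> R.
Hypothesis mu_ge0 : forall a, 0 <= mu a.
Hypothesis mu_sum1 : \sum_a mu a = 1.
Variables (eta : R) (s : nat).
Hypothesis eta_le1 : eta <= 1.
Hypothesis conv_ge : forall m a, (s <= m)%N -> (1 - eta) / p%:R <= conv mu m a.

Lemma avg1_minor (X : finType) (W : {set X}) t h w :
  (forall v, 0 <= h v) -> (s <= #|W|)%N ->
  (1 - eta) * avg1 t h w <= Ex mu (fun y => h (w + (\sum_(i in W) y i) *: t)).
Proof.
move=> h0 sW; rewrite (Ex_sum_coord mu_sum1 W (fun a => h (w + a *: t))).
rewrite /avg1 mulrA mulr_sumr; apply: ler_sum => a _.
by rewrite ler_wpM2r // conv_ge.
Qed.

(** Coordinates sharing the coefficient vector [t] contribute their sum times [t]. A group of at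
    least [s] coordinates has a nearly uniform sum, so each vector of [ts] costs one factor
    [1 - eta]. *)
Lemma avg_minor (X : finType) (col : X -> V) ts (W : {set X}) h w :
  (forall v, 0 <= h v) -> uniq ts -> (forall i, i \in W -> col i \in ts) ->
  (forall t, t \in ts -> (s <= #|[set i in W | col i == t]|)%N) ->
  (1 - eta) ^+ size ts * avg ts h w <=
  Ex mu (fun y => h (w + \sum_(i in W) y i *: col i)).
Proof.
move=> h0; elim: ts W w => [|t ts IH] W w /=.
  move=> _ Wts _; rewrite mul1r; under eq_Ex do rewrite big1 => [|i /Wts //].
  by rewrite (Ex_cst mu_sum1) addr0.
move=> /andP[tts uts] Wts sW.
pose W1 := [set i in W | col i == t]%SET; pose W2 := W :\: W1.
rewrite (Ex_splice mu_sum1 W2).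
apply: (@le_trans _ _ ((1 - eta) ^+ size ts *
    Ex mu (fun x => avg ts h (w + (\sum_(i in W1) x i) *: t)))).
  rewrite exprSr -mulrA ler_wpM2l ?exprn_ge0 ?subr_ge0 //.
  by apply: avg1_minor; [move=> v; apply: avg_ge0 | apply: sW; rewrite mem_head].
rewrite -ExZ; apply: Ex_le => // x.
apply: le_trans (IH W2 _ uts _ _) _.
- move=> i; rewrite !inE => /andP[+ iW]; rewrite iW /= => it.
  by have := Wts i iW; rewrite inE (negPf it).
- move=> t' t'ts; apply: leq_trans (sW t' _) _; first by rewrite inE t'ts orbT.
  apply/subset_leq_card/fintype.subsetP => i; rewrite !inE => /andP[-> /eqP ->].
  by rewrite eqxx !andbT /=; apply: contraNN tts => /eqP <-.
rewrite le_eqVlt; apply/orP; left; apply/eqP; apply: eq_Ex => y; congr h.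
rewrite -addrA; congr (_ + _).
have -> : \sum_(i in W) splice W2 x y i *: col i =
    \sum_(i in W1) splice W2 x y i *: col i + \sum_(i in W2) splice W2 x y i *: col i.
  rewrite (big_setID W1) /=; congr (_ + _); apply: eq_bigl => i.
  by rewrite !inE andbA andbb.
rewrite scaler_suml; congr (_ + _); apply: eq_bigr => i; last first.
  by move=> iW; rewrite ffunE iW.
by rewrite ffunE !inE => /andP[-> /eqP ->]; rewrite eqxx.
Qed.

End Minorization.

End Averages.

(** * Hitting a set with one of many blocks *)

Lemma expr_1B_ge (R : realFieldType) (e : R) (n : nat) :
  0 <= e <= 1 -> 1 - n%:R * e <= (1 - e) ^+ n.
Proof.
move=> /andP[e0 e1]; elim: n => [|n IH]; first by rewrite mul0r subr0 expr0.
rewrite exprS -natr1; apply: le_trans (_ : (1 - e) * (1 - n%:R * e) <= _).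
  have : 0 <= n%:R * e * e by rewrite !mulr_ge0.
  by lra.
by rewrite ler_wpM2l // subr_ge0.
Qed.

(** In [hit_some_block], [a] is the probability that no block is good, [s] that some block is good,
    and [b] that some block is good but the target is missed. *)
Lemma miss_bound (R : realFieldType) (e g s a b : R) :
  0 <= e -> 0 <= g <= 1 -> s <= 1 -> a <= e / 2 ->
  b <= (1 - (1 - e / 2) * g) * s -> a + b <= 1 - g + e.
Proof.
move=> e0 /andP[g0 g1] s1 ae bs.
have eg0 := mulr_ge0 e0 g0; have eg1 := ler_piMr e0 g1.
have c0 : 0 <= 1 - (1 - e / 2) * g by lra.
have := ler_piMr c0 s1; lra.
Qed.

(** Pigeonhole: the intervals between consecutive thresholds are disjoint, so each [t] spoils at
    most one of the [#|T| + 1] indices. *)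
Lemma exists_gap (T : finType) (c : T -> nat) (S : nat -> nat) :
  {homo S : i j / (i <= j)%N} ->
  exists i : 'I_#|T|.+1, forall t, (c t <= S i)%N || (S i.+1 < c t)%N.
Proof.
move=> Smono; apply: contrapT => /forallNP H.
have /choice[f fP] : forall i : 'I_#|T|.+1, exists t,
    ~~ ((c t <= S i)%N || (S i.+1 < c t)%N).
  move=> i; have /existsNP[t /negP tP] := H i.
  by exists t.
have finj : injective f.
  suff lt (i j : 'I_#|T|.+1) : (i < j)%N -> f i != f j.
    move=> i j fij; apply/eqP; case: (ltngtP i j) => [ij|ji|/val_inj ->] //.
      by have := lt _ _ ij; rewrite fij eqxx.
    by have := lt _ _ ji; rewrite fij eqxx.
  move=> ij; apply/eqP => fij.
  have := fP i; have := fP j; rewrite fij !negb_or -!ltnNge !ltnS.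
  move=> /andP[jc _] /andP[_ ci].
  by have := leq_trans jc (leq_trans ci (Smono _ _ ij)); rewrite ltnn.
by have := leq_card f finj; rewrite card_ord ltnn.
Qed.

Section BlockLemma.
Variables (R : realType) (p : nat) (mu : 'F_p -> R).
Hypothesis p_prime : prime p.
Hypothesis mu_ge0 : forall a, 0 <= mu a.
Hypothesis mu_sum1 : \sum_a mu a = 1.
Variables (u v : 'F_p) (kappa : R).
Hypothesis uv : u != v.
Hypothesis kappa_gt0 : 0 < kappa.
Hypothesis mu_u : kappa <= mu u.
Hypothesis mu_v : kappa <= mu v.
Variable d : nat.
Local Notation V := 'rV['F_p]_d.

Lemma avg_shift (h : V -> R) (ts : seq V) (t w : V) (a : 'F_p) :
  t \in ts -> avg ts h (w + a *: t) = avg ts h w.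
Proof.
elim: ts w => // t0 ts IH w; rewrite inE => /orP[/eqP ->|tts] /=.
  rewrite /avg1 (reindex_inj (addIr (- a))) /=; congr (_ * _).
  by apply: eq_bigr => b _; rewrite -addrA -scalerDl addrCA subrr addr0.
by rewrite /avg1; congr (_ * _); apply: eq_bigr => b _; rewrite addrAC IH.
Qed.

Lemma avg_shift_sum (h : V -> R) (ts : seq V) (X : finType) (D : {set X})
    (x : X -> 'F_p) (col : X -> V) (w : V) :
  (forall i, i \in D -> col i \in ts) ->
  avg ts h (w + \sum_(i in D) x i *: col i) = avg ts h w.
Proof.
move=> Dts; move: w.
apply: (big_ind (fun s => forall w, avg ts h (w + s) = avg ts h w)).
- by move=> w; rewrite addr0.
- by move=> s t IHs IHt w; rewrite addrA IHt IHs.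
- by move=> i iD w; rewrite avg_shift // Dts.
Qed.

Let kappa_le1 : kappa <= 1.
Proof.
apply: le_trans mu_u _; rewrite -mu_sum1 (bigD1 u) //= lerDl.
exact: sumr_ge0.
Qed.

Section Structure.
Variables (X B : finType) (q : B -> 'I_d -> X) (L : B -> X -> V).
Hypothesis q_inj : forall k j k' j', q k j = q k' j' -> k = k' /\ j = j'.

Definition block k : {set X} := [set q k j | j in 'I_d]%SET.
Definition type_count k t := #|[set i | (i \notin block k) && (L k i == t)]%SET|.
(* The values of the map of a block [k] are nearly uniform modulo its
   restriction to the coordinates in [atypical b k], as every other coordinate
   has a coefficient vector shared by more than [b] coordinates. *)
Definition popular b k : seq V := [seq t <- enum {: V} | (b < type_count k t)%N].
Definition atypical b k : {set X} := block k :|: [set i | L k i \notin popular b k]%SET.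

Lemma card_block k : #|block k| = d.
Proof. by rewrite card_imset ?card_ord // => j j' /q_inj[]. Qed.

Lemma card_atypical b k : (#|atypical b k| <= d + #|{: V}| * b)%N.
Proof.
pose N := [set i | (i \notin block k) && (L k i \notin popular b k)]%SET.
apply: (@leq_trans (#|block k| + #|N|)).
  apply: leq_trans (leq_card_setU _ _); apply/subset_leq_card/fintype.subsetP => i.
  by rewrite !inE; case: (i \in block k).
rewrite card_block leq_add2l -sum1_card (partition_big (L k) xpredT) //=.
apply: (@leq_trans (\sum_(t : V) b)); last by rewrite sum_nat_const.
apply: leq_sum => t _; rewrite sum1_card.
have [tp|tp] := boolP (t \in popular b k).
  rewrite eq_card0 // => i; rewrite unfold_in /= inE.
  by case: eqP => [->|]; rewrite ?tp ?andbF.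
move: tp; rewrite mem_filter mem_enum andbT -leqNgt; apply: leq_trans.
apply/subset_leq_card/fintype.subsetP => i; rewrite unfold_in /= !inE.
by move=> /andP[/andP[-> _] ->].
Qed.

(** Greedy choice: blocks are pairwise disjoint, so at most [#|U|] of them meet the union [U] of the
    atypical sets already chosen. Each new block is put at the head of the list. *)
Lemma pick_blocks (Ks : {set B}) b m :
  (m * (d + #|{: V}| * b) < #|Ks|)%N ->
  exists ks : seq B, [/\ size ks = m, all (mem Ks) ks &
    pairwise (fun k k' => [disjoint block k & atypical b k']) ks].
Proof.
elim: m => [|m IH] mK; first by exists [::].
have [|ks [sz kK pw]] := IH; first by apply: leq_ltn_trans mK; rewrite leq_mul2r leqnSn orbT.
pose U := (\bigcup_(k <- ks) atypical b k)%SET.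
have cU : (#|U| <= m * (d + #|{: V}| * b))%N.
  rewrite -sz /U; elim: (ks) => [|k s IHs]; first by rewrite big_nil cards0.
  rewrite big_cons /= mulSn; apply: leq_trans (leq_card_setU _ _) _.
  by rewrite leq_add ?card_atypical.
have [k kKs kU] : exists2 k, k \in Ks & [disjoint block k & U].
  apply: contrapT => no_k.
  have none k : k \in Ks -> ~~ [disjoint block k & U].
    by move=> kKs; apply/negP => kU; apply: no_k; exists k.
  pose f k := [pick i in block k :&: U].
  have fP k : k \in Ks -> exists2 i, f k = Some i & i \in block k :&: U.
    move=> /none; rewrite -setI_eq0 => /set0Pn[i0 i0P].
    by rewrite /f; case: pickP => [i|/(_ i0)]; [exists i|rewrite i0P].
  have f_inj : {in Ks &, injective f}.
    move=> k k' /fP[i -> iP] /fP[i' -> iP'] [ii].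
    move: iP iP'; rewrite -{}ii !inE => /andP[/imsetP[j _ ->] _] /andP[/imsetP[j' _ +] _].
    by move=> /q_inj[].
  suff : (#|Ks| <= #|U|)%N.
    by rewrite leqNgt (leq_ltn_trans cU) //; apply: leq_ltn_trans mK; rewrite leq_mul2r leqnSn orbT.
  have SomeI : injective (@Some X) by move=> i i' [].
  rewrite -(card_in_imset f_inj) -(card_imset (mem U) SomeI).
  apply/subset_leq_card/fintype.subsetP => o /imsetP[k /fP[i -> iP] ->].
  by move: iP; rewrite inE => /andP[_ iU]; apply: imset_f.
exists (k :: ks); rewrite /= sz kKs kK pw; split=> //.
rewrite andbT; apply/allP => k' k'ks; apply: disjointWr kU.
by rewrite /U (big_rem k') //= finset.subsetUl.
Qed.

Variables (G : pred V) (gamma : R) (b : nat).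

Local Notation h := (fun w : V => (G w)%:R : R).

(** Given the atypical coordinates, the target would be hit with probability at least [gamma] if the
    popular groups had exactly uniform sums. *)
Definition good k (x : {ffun X -> 'F_p}) : Prop :=
  gamma <= avg (popular b k) h (\sum_(i in atypical b k) x i *: L k i).

Hypothesis steer : forall k ts w, uniq ts ->
  exists a : 'I_d -> 'F_p, (forall j, a j = u \/ a j = v) /\
    gamma <= avg ts h (w + \sum_j a j *: L k (q k j)).

Lemma block_sub k : block k \subset atypical b k.
Proof. exact: finset.subsetUl. Qed.

Lemma good_splice k (Z : {set X}) x y :
  [disjoint Z & atypical b k] -> good k (splice Z x y) -> good k x.
Proof.
move=> dis; rewrite /good; set s1 := \sum_(i in _) _; set s2 := \sum_(i in _) _.
have -> // : s1 = s2.
apply: eq_bigr => i iA; rewrite ffunE.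
by move: dis; rewrite disjoint_sym => /disjointFr ->.
Qed.

Lemma not_good_splice k (Z : {set X}) x y :
  [disjoint Z & atypical b k] -> ~ good k (splice Z x y) -> ~ good k x.
Proof.
move=> dis ng gx; apply: ng; apply: (@good_splice k Z _ x) => //.
suff -> : splice Z (splice Z x y) x = x by [].
by apply/ffunP => i; rewrite !ffunE; case: (i \in Z).
Qed.

(** Whatever the other atypical coordinates are, [steer] provides values in [{u, v}] on the block
    that make it good, and the block takes them with probability at least [kappa ^+ d]. *)
Lemma Pr_not_good_block k x :
  Pr mu (fun y => ~ good k (splice (block k) x y)) <= 1 - kappa ^+ d.
Proof.
have [a [auv aP]] := steer k (\sum_(i in atypical b k :\: block k) x i *: L k i)
  (filter_uniq (fun t => (b < type_count k t)%N) (enum_uniq {: V})).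
pose a' (i : X) := if [pick j | q k j == i] is Some j then a j else 0.
have a'E j : a' (q k j) = a j.
  rewrite /a'; case: pickP => [j' /eqP /q_inj[_ ->] //|/(_ j)].
  by rewrite eqxx.
rewrite (Pr_not mu_sum1) lerD2l lerN2.
apply: (@le_trans _ _ (Pr mu (fun y : {ffun X -> 'F_p} =>
    forall i, i \in block k -> y i = a' i))).
  rewrite (Pr_box mu_sum1) -(card_block k) -prodr_const.
  apply: ler_prod => i /imsetP[j _ ->]; rewrite a'E (ltW kappa_gt0) /=.
  by case: (auv j) => ->.
apply: Pr_le => // y yb; rewrite /good.
rewrite (big_setID (block k)) /= (finset.setIidPr (block_sub k)) addrC.
have -> : \sum_(i in block k) splice (block k) x y i *: L k i =
    \sum_j a j *: L k (q k j).
  rewrite big_imset /=; last by move=> j j' _ _ /q_inj[].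
  apply: eq_bigr => j _.
  by rewrite ffunE imset_f // yb ?imset_f // a'E.
have -> // : \sum_(i in atypical b k :\: block k) splice (block k) x y i *: L k i =
    \sum_(i in atypical b k :\: block k) x i *: L k i.
by apply: eq_bigr => i; rewrite inE ffunE => /andP[/negPf ->].
Qed.

(** Resampling the first block does not touch the atypical coordinates of the later ones, hence not
    their goodness. Each block therefore contributes its own factor. *)
Lemma Pr_none_good ks :
  pairwise (fun k k' => [disjoint block k & atypical b k']) ks ->
  Pr mu (fun x => forall k, k \in ks -> ~ good k x) <= (1 - kappa ^+ d) ^+ size ks.
Proof.
elim: ks => [|k ks IH] /=; first by move=> _; rewrite expr0 Pr_le1.
move=> /andP[/allP dis /IH{}IH].
pose A x := forall k', k' \in ks -> ~ good k' x.
apply: (@le_trans _ _ (Pr mu (fun x => A x /\ ~ good k x))).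
  apply: Pr_le => // x kg; split; last by apply: kg; rewrite mem_head.
  by move=> k' k'ks; apply: kg; rewrite inE k'ks orbT.
apply: (le_trans (@Pr_splice_le _ _ _ mu_ge0 mu_sum1 _ (block k) _ _ (1 - kappa ^+ d) _ _)).
- by move=> x y Ax k' k'ks; apply: not_good_splice (Ax _ k'ks); apply: dis.
- by move=> x _; apply: Pr_not_good_block.
rewrite exprS ler_wpM2l // subr_ge0 exprn_ile1 //; exact: ltW.
Qed.

Variables (eta : R) (s : nat).
Hypothesis eta_le1 : eta <= 1.
Hypothesis conv_ge : forall m a, (s <= m)%N -> (1 - eta) / p%:R <= conv mu m a.

(** The coordinates of [U] that are not atypical have popular vectors and do not change the average.
    Outside [U] every popular group still has at least [s] members, so [avg_minor] applies. *)
Lemma Pr_hit_given_good (U : {set X}) k x :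
  atypical b k \subset U -> good k x ->
  (forall t, t \in popular b k -> (#|U| + s <= type_count k t)%N) ->
  (1 - eta) ^+ size (popular b k) * gamma <=
  Pr mu (fun y => G (\sum_i splice (~: U) x y i *: L k i)).
Proof.
move=> aU gx big_type.
have popularE i : i \notin atypical b k -> L k i \in popular b k.
  by rewrite !inE negb_or negbK => /andP[].
apply: (@le_trans _ _ ((1 - eta) ^+ size (popular b k) *
    avg (popular b k) h (\sum_(i in U) x i *: L k i))).
  rewrite ler_wpM2l ?exprn_ge0 ?subr_ge0 //.
  rewrite (big_setID (atypical b k)) /= (finset.setIidPr aU) avg_shift_sum //.
  by move=> i; rewrite inE => /andP[/popularE].
apply: (le_trans (avg_minor p_prime mu_ge0 mu_sum1 eta_le1 conv_ge (W := ~: U) (col := L k) _ _ _ _ _)).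
- by move=> w; rewrite ler0n.
- by rewrite filter_uniq // enum_uniq.
- move=> i; rewrite inE => iU; apply: popularE; apply: contra iU.
  exact: (fintype.subsetP aU).
- move=> t /big_type tU; rewrite -(leq_add2l #|U|); apply: leq_trans tU _.
  apply: leq_trans (leq_card_setU _ _); apply/subset_leq_card/fintype.subsetP => i.
  by rewrite !inE => /andP[_ ->]; case: (i \in U).
rewrite le_eqVlt; apply/orP; left; apply/eqP; apply: eq_Ex => y.
rewrite asboolb; congr (G _)%:R.
rewrite [RHS](bigID (mem U)) /=; congr (_ + _).
  by apply: eq_bigr => i iU; rewrite ffunE inE iU.
by apply: eq_big => i; rewrite ?inE // ffunE inE => ->.
Qed.

End Structure.

(* The bound [b] separating small groups from large ones depends on the block:
   for the increasing thresholds [S], some [i] is such that no group of the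
   block has size in [(S i, S i.+1]], and [S i.+1] exceeds the total number of
   atypical coordinates of [m] blocks using the threshold [S i]. *)
Lemma hit_some_block (eps : R) : 0 < eps ->
  exists N, forall (X B : finType) (q : B -> 'I_d -> X) (L : B -> X -> V)
      (G : pred V) (gamma : R),
    (N <= #|B|)%N ->
    (forall k j k' j', q k j = q k' j' -> k = k' /\ j = j') ->
    0 <= gamma <= 1 ->
    (forall k ts w, uniq ts -> exists a : 'I_d -> 'F_p,
      (forall j, a j = u \/ a j = v) /\
      gamma <= avg ts (fun w => (G w)%:R) (w + \sum_j a j *: L k (q k j))) ->
    Pr mu (fun x => ~ exists k, G (\sum_i x i *: L k i)) <= 1 - gamma + eps.
Proof.
move=> eps0; have eps2 : 0 < eps / 2 by rewrite divr_gt0.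
have kd0 : 0 < kappa ^+ d by rewrite exprn_gt0.
have kd1 : kappa ^+ d <= 1 by rewrite exprn_ile1 // ltW.
have [|m mP] := @expr_small R (1 - kappa ^+ d) (eps / 2) _ eps2.
  by rewrite subr_ge0 kd1 /= ltrBlDr ltrDl.
pose r := #|{: V}|.
(* At most [r] vectors are popular, so by Bernoulli's inequality the total loss [(1 - eta) ^+ r] is
   at least [1 - eps / 2]. *)
pose eta := Num.min 1 (eps / 2 / r.+1%:R).
have eta0 : 0 < eta by rewrite lt_min ltr01 divr_gt0 // ltr0n.
have eta1 : eta <= 1 by rewrite ge_min lexx.
have etaP : 1 - eps / 2 <= (1 - eta) ^+ r.
  apply: le_trans (expr_1B_ge r _); last by rewrite ltW.
  rewrite lerD2l lerN2 (@le_trans _ _ (r.+1%:R * (eps / 2 / r.+1%:R))) //.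
    by apply: ler_pM; rewrite ?ler0n ?ler_nat ?(ltW eta0) // ge_min lexx orbT.
  by rewrite mulrC divfK // pnatr_eq0.
have [s sP] := conv_equidistributed p_prime mu_ge0 mu_sum1 uv kappa_gt0 mu_u mu_v eta0.
pose S := fix S i := if i is i'.+1 then (S i' + m * (d + r * S i') + s)%N else 0%N.
have Smono : {homo S : i j / (i <= j)%N}.
  apply: homo_leq => [//|i j k|i]; first exact: leq_trans.
  by rewrite /= -addnA leq_addr.
exists (\sum_(i < r.+1) m * (d + r * S i)).+1%N => X B q L G gamma NB q_inj.
move=> /andP[gamma0 gamma1] steer.
have /choice[gap gapP] := fun k => exists_gap (type_count q L k) Smono.
(* Pigeonhole over the gap indices: the size of [B] forces enough blocks to share one threshold for
   [pick_blocks]. *)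
have [i iP] : exists i : 'I_r.+1, (m * (d + r * S i) < #|[set k | gap k == i]%SET|)%N.
  apply: contrapT => /forallNP none; move: NB; rewrite ltnNge => /negP; apply.
  rewrite -sum1_card (partition_big gap xpredT) //=.
  apply: leq_sum => i _; rewrite sum1dep_card leqNgt; apply/negP; exact: none.
have [ks [sz /allP kK pw]] := pick_blocks L q_inj iP.
pose U := (\bigcup_(k <- ks) atypical q L (S i) k)%SET.
have cU : (#|U| <= m * (d + r * S i))%N.
  rewrite -sz /U; elim: (ks) => [|k s' IHs]; first by rewrite big_nil cards0.
  rewrite big_cons /= mulSn; apply: leq_trans (leq_card_setU _ _) _.
  by rewrite leq_add ?card_atypical.
have aU k : k \in ks -> atypical q L (S i) k \subset U.
  by move=> kks; rewrite /U (big_rem k) //= finset.subsetUl.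
pose some_good (x : {ffun X -> 'F_p}) := exists2 k, k \in ks & good q L G gamma (S i) k x.
pose miss (x : {ffun X -> 'F_p}) := ~ exists k, G (\sum_i x i *: L k i).
apply: (@le_trans _ _ (Pr mu (fun x => forall k, k \in ks -> ~ good q L G gamma (S i) k x)
    + Pr mu (fun x => some_good x /\ miss x))).
  apply: le_trans (Pr_or _ _ _) => //; apply: Pr_le => // x mx.
  have [gx|ngx] := pselect (some_good x); [by right|left=> k kks gk].
  by apply: ngx; exists k.
have le1 := Pr_none_good q_inj steer pw; rewrite sz in le1.
have le2 : Pr mu (fun x => some_good x /\ miss x) <= (1 - (1 - eps / 2) * gamma) * Pr mu some_good.
  apply: (Pr_splice_le mu_ge0 mu_sum1 (Z := ~: U)).
    move=> x y [k kks gk]; exists k => //; apply: good_splice gk.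
    by rewrite disjoint_sym finset.disjoints_subset finset.setCK aU.
  move=> x [k kks gx].
  apply: (@le_trans _ _ (Pr mu (fun y => ~ G (\sum_i splice (~: U) x y i *: L k i)))).
    by apply: Pr_le => // y my Gk; apply: my; exists k.
  rewrite (Pr_not mu_sum1) lerD2l lerN2.
  apply: le_trans _ (Pr_hit_given_good eta1 sP (aU k kks) gx _); last first.
    move=> t; rewrite mem_filter => /andP[St _].
    have := gapP k t; have /= := kK k kks; rewrite inE => /eqP ->.
    rewrite leqNgt St /=; apply: leq_trans; rewrite /= leqW // leq_add2r.
    by apply: leq_trans cU _; rewrite leq_addl.
  rewrite ler_wpM2r //; apply: le_trans etaP _.
  rewrite ler_wiXn2l ?subr_ge0 // ?gerBl ?(ltW eta0) //.
  by rewrite size_filter; apply: leq_trans (count_size _ _) _; rewrite -cardE.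
apply: (@miss_bound _ _ _ (Pr mu some_good)) le2 => //; first exact: ltW.
- by rewrite gamma0.
- by rewrite Pr_le1.
- exact: le_trans le1 mP.
Qed.

End BlockLemma.

Section ManyBlocks.
Variables (R : realType) (p : nat) (mu : 'F_p -> R).
Hypothesis p_prime : prime p.
Hypothesis mu_ge0 : forall a, 0 <= mu a.
Hypothesis mu_sum1 : \sum_a mu a = 1.
Variables (u v : 'F_p) (kappa : R).
Hypothesis uv : u != v.
Hypothesis kappa_gt0 : 0 < kappa.
Hypothesis mu_u : kappa <= mu u.
Hypothesis mu_v : kappa <= mu v.

Lemma small_ratio (K : nat) (eps : R) : 0 < eps ->
  exists r : nat, (0 < r)%N /\ K%:R / r%:R <= eps.
Proof.
move=> eps0; exists (Num.bound (K%:R / eps)).+1; split=> //.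
have /ltW le1 := archi_boundP (divr_ge0 (ler0n _ K) (ltW eps0)).
rewrite ler_pdivrMr ?ltr0n // -ler_pdivrMl // mulrC.
by apply: le_trans le1 _; rewrite ler_nat.
Qed.

(** The blocks are divided into [r] groups of [N0]. Each group contains a hit with probability at
    least [gamma - eps / 2], and Markov's inequality bounds the chance that fewer than [K] groups
    do, at the cost of [K / r]. *)
Lemma hit_many_blocks (d K : nat) (eps : R) : 0 < eps ->
  exists N, forall (X : finType) (q : 'I_N -> 'I_d -> X)
      (L : 'I_N -> X -> 'rV['F_p]_d) (G : pred 'rV['F_p]_d) (gamma : R),
    (forall k j k' j', q k j = q k' j' -> k = k' /\ j = j') ->
    0 <= gamma <= 1 ->
    (forall k ts w, uniq ts -> exists a : 'I_d -> 'F_p,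
      (forall j, a j = u \/ a j = v) /\
      gamma <= avg ts (fun w => (G w)%:R) (w + \sum_j a j *: L k (q k j))) ->
    Pr mu (fun x => (#|[set k | G (\sum_i x i *: L k i)%R]%SET| < K)%N)
      <= 1 - gamma + eps.
Proof.
move=> eps0; have eps2 : 0 < eps / 2 by rewrite divr_gt0.
have [N0 N0P] := hit_some_block p_prime mu_ge0 mu_sum1 uv kappa_gt0 mu_u mu_v d eps2.
have [r [r0 rP]] := small_ratio K eps2.
exists #|{: 'I_r * 'I_N0}| => X q L G gamma q_inj gamma01 steer.
pose V (x : {ffun X -> 'F_p}) k := \sum_i x i *: L k i.
pose E i x := exists j, G (V x (enum_rank (i, j))).
have bad i : Pr mu (fun x => ~ E i x) <= 1 - gamma + eps / 2.
  apply: (N0P _ _ (fun j => q (enum_rank (i, j))) (fun j => L (enum_rank (i, j)))) => //.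
  - by rewrite card_ord.
  - by move=> k j k' j' /q_inj[/enum_rank_inj[->] ->].
  - by move=> k; apply: steer.
have rI : (0 < #|'I_r|)%N by rewrite card_ord.
have := Pr_few mu_ge0 mu_sum1 K bad rI; rewrite card_ord => few.
apply: le_trans (_ : _ <= 1 - gamma + eps / 2 + K%:R / r%:R) _; last by lra.
apply: le_trans few; apply: Pr_le => // x; apply: leq_ltn_trans.
apply: leq_trans (leq_imset_card (fun k => (enum_val k).1) _).
apply/subset_leq_card/fintype.subsetP => i; rewrite inE => /asboolP[j Gj].
by apply/imsetP; exists (enum_rank (i, j)); rewrite ?inE ?enum_rankK.
Qed.

(** * Greedy extension of nonzero subpermanents *)

Variable rho : R.
Hypothesis rho_gt0 : 0 < rho.
Hypothesis mu_rho : forall a, mu a <= rho.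
Hypothesis rho_lt1 : rho < 1.

Local Notation sub a := (subper (fun i j => a (i, j))).

Lemma splice_splice (X : finType) (Z1 Z2 : {set X}) (x y z : {ffun X -> 'F_p}) :
  Z2 \subset Z1 -> splice Z1 x (splice Z2 y z) = splice Z2 (splice Z1 x y) z.
Proof.
move=> /fintype.subsetP Z21; apply/ffunP => i; rewrite !ffunE.
by case: ifP => [iZ1|/negP iZ1]; case: ifP => // /Z21.
Qed.

(** The rows of [U] are added one at a time. With [k] rows to follow, [k + e + 1] fresh columns are
    available, and the row fails only if all its entries there take prescribed values, with
    probability at most [rho ^+ (k + e + 1)]. The bound is the sum of this geometric series,
    multiplied by [1 - rho]. *)
Lemma greedy_extension (I J : finType) (e : nat) (M : {set J}) (U A : {set I})
    (S D : {set J}) (x : {ffun I * J -> 'F_p}) :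
  [disjoint U & A] -> S \subset D -> D :\: S \subset M ->
  #|D| = (#|S| + #|U| + e)%N -> sub x A S != 0 ->
  (1 - rho) * Pr mu (fun y => ~ exists S' : {set J}, [/\ S \subset S', S' \subset D,
      #|S'| = (#|S| + #|U|)%N & sub (splice (finset.setX U M) x y) (U :|: A) S' != 0])
  <= rho ^+ e.+1 * (1 - rho ^+ #|U|).
Proof.
have [n] := ubnP #|U|; elim: n U A S x => // n IH U A S x.
have [->|[r rU]] := set_0Vmem U.
  move=> _ _ SD _ _ nz; rewrite cards0 subrr mulr0.
  rewrite (_ : Pr _ _ = 0) ?mulr0 //; apply/le_anti; rewrite Pr_ge0 // andbT.
  rewrite -[leRHS](Ex_cst mu_sum1 (I * J)%type 0); apply: Ex_le => // y; case: asboolP => //; case.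
  exists S; rewrite addn0 finset.set0U; split=> //.
  by rewrite (_ : splice _ _ _ = x) //; apply/ffunP => -[i j]; rewrite ffunE !inE.
set U' := U :\ r; have cU : #|U| = #|U'|.+1 by rewrite (cardsD1 r) rU.
rewrite cU ltnS => ltU' dUA SD DSM cD nz.
have rA : r \notin A by rewrite (disjointFr dUA rU).
have r0 := rho_gt0.
pose x1 y := splice (finset.setX U M) x y.
pose A1 y := exists2 j, j \in D :\: S & sub (x1 y) (r |: A) (j |: S) != 0.
have subA y (S0 : {set J}) : sub (x1 y) A S0 = sub x A S0.
  apply: eq_subper => i j iA _; rewrite ffunE inE.
  by rewrite (disjointFl dUA iA).
have pA1 : Pr mu (fun y => ~ A1 y) <= rho ^+ (#|U'| + e).+1.
  pose Z1 := finset.setX [set r]%SET (D :\: S).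
  have cZ1 : #|Z1| = (#|U'| + e).+1.
    rewrite finset.cardsX cards1 mul1n cardsD (finset.setIidPr SD) cD.
    by rewrite -addnA addKn.
  rewrite -cZ1; apply: (Pr_splice_le_all mu_ge0 mu_sum1 (Z := Z1)) => y.
  (* By expansion along row [r], this is the only value of the entry for which adding column [z.2]
     gives a zero subpermanent. *)
  pose b (z : I * J) := - (\sum_(i in S) x1 y (r, i) * sub x A ((z.2 |: S) :\ i)) / sub x A S.
  apply: le_trans (Pr_box_le mu_ge0 mu_sum1 Z1 b mu_rho); apply: Pr_le => // y' nA1.
  move=> [i j]; rewrite !inE /= => /andP[/eqP -> /andP[jS jD]].
  apply: (mulIf nz); rewrite /b divfK //=.
  apply/eqP; rewrite -addr_eq0; apply: contra_notT nA1 => neq.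
  exists j; first by rewrite inE jS.
  rewrite subper_row // big_setU1 //= setU1K // subA; apply: contraNneq neq => eq0.
  rewrite -{}[X in _ == X]eq0; apply/eqP; congr (_ * _ + _).
    rewrite !ffunE !inE rU /= jS jD eqxx /=.
    by rewrite (fintype.subsetP DSM) // inE jS.
  apply: eq_bigr => k kS; rewrite subA; congr (_ * _).
  by rewrite !ffunE !inE eqxx /= kS.
have pbad : (1 - rho) * Pr mu (fun y => A1 y /\ ~ exists S' : {set J},
      [/\ S \subset S', S' \subset D, #|S'| = (#|S| + #|U'|.+1)%N &
          sub (x1 y) (U :|: A) S' != 0]) <= rho ^+ e.+1 * (1 - rho ^+ #|U'|).
  have r1 : 0 < 1 - rho by rewrite subr_gt0.
  have b0 : 0 <= rho ^+ e.+1 * (1 - rho ^+ #|U'|) / (1 - rho).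
    rewrite divr_ge0 ?(ltW r1) // mulr_ge0 ?exprn_ge0 ?(ltW r0) // subr_ge0.
    by rewrite exprn_ile1 ?ltW.
  rewrite mulrC -ler_pdivlMr //.
  apply: le_trans _ (ler_piMr b0 (Pr_le1 mu_ge0 mu_sum1 A1)).
  have U'U : U' \subset U by rewrite subD1set.
  have rU' : r \notin U' by rewrite !inE eqxx.
  have dU'A i : i \in r |: A -> (i \in U') = false.
    rewrite inE => /orP[/set1P ->|iA]; first exact/negbTE.
    by apply/negbTE; apply: contraL iA => /(fintype.subsetP U'U)/(disjointFr dUA) ->.
  apply: (Pr_splice_le mu_ge0 mu_sum1 (Z := finset.setX U' M)).
    move=> y y' [j jDS nz']; exists j => //; move: nz'.
    rewrite (eq_subper (b := fun i k => x1 y (i, k))) // => i k iA _.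
    by rewrite !ffunE !finset.in_setX /= dU'A.
  move=> y [j jDS nz'].
  have jS : j \notin S by move: jDS; rewrite inE => /andP[].
  rewrite ler_pdivlMr // mulrC.
  have := IH U' (r |: A) (j |: S) (x1 y) ltU'.
  have -> : [disjoint U' & r |: A].
    by apply/pred0P => i /=; apply/negbTE/negP => /andP[iU' iA]; rewrite dU'A in iU'.
  have -> : j |: S \subset D.
    by rewrite finset.subUset finset.sub1set SD andbT; move: jDS; rewrite inE => /andP[].
  have -> : D :\: (j |: S) \subset M.
    apply: fintype.subset_trans DSM; rewrite finset.setDS //; exact: finset.subsetUr.
  have cjS : #|j |: S| = #|S|.+1 by rewrite cardsU1 jS.
  rewrite cjS => /(_ isT isT isT) IHy.
  apply: le_trans _ (IHy _ nz'); last by rewrite cD addSnnS.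
  rewrite ler_wpM2l ?(ltW r1) //; apply: Pr_le => // y' bad [S' [S'1 S'2 S'3 S'4]].
  apply: bad; exists S'; split=> //.
  - by apply: fintype.subset_trans S'1; apply: finset.subsetUr.
  - by rewrite S'3 addSnnS.
  have -> : U :|: A = U' :|: (r |: A).
    by apply/setP => i; rewrite !inE; case: (eqVneq i r) => [->|_]; rewrite ?rU ?orbT.
  by rewrite /x1 splice_splice //; apply: finset.setXS.
apply: (@le_trans _ _ ((1 - rho) * (Pr mu (fun y => ~ A1 y) + Pr mu (fun y => A1 y /\
    ~ exists S' : {set J}, [/\ S \subset S', S' \subset D,
      #|S'| = (#|S| + #|U'|.+1)%N & sub (x1 y) (U :|: A) S' != 0])))).
  rewrite ler_wpM2l ?subr_ge0 ?(ltW rho_lt1) //; apply: le_trans (Pr_or _ _ _) => //.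
  apply: Pr_le => // y bad; have [a1|na1] := pselect (A1 y); first by right.
  by left.
have r1 : 0 <= 1 - rho by rewrite subr_ge0 ltW.
have := ler_wpM2l r1 pA1; rewrite mulrDr => le1.
apply: le_trans (lerD le1 pbad) _; rewrite le_eqVlt; apply/orP; left; apply/eqP.
by rewrite -addnS exprD !exprS; ring.
Qed.

End ManyBlocks.

(** * Robust families of minors *)

Definition lead (n t : nat) : {set 'I_n} := [set i : 'I_n | (i < n - t)%N]%SET.

(* [t] is meant to be the cardinal of [I]. *)
Definition minor (p n : nat) (a : {ffun 'I_n * 'I_n -> 'F_p}) (t : nat)
    (I : {set 'I_n}) : 'F_p :=
  subper (fun i j => a (i, j)) (lead n t) (~: I).

Definition disjoint_family (X : Type) (K d : nat) (q : 'I_K -> 'I_d -> X) : Prop :=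
  forall k j k' j', q k j = q k' j' -> k = k' /\ j = j'.

Definition robust (p n : nat) (t K : nat) (a : {ffun 'I_n * 'I_n -> 'F_p}) : Prop :=
  exists2 q : 'I_K -> 'I_t -> 'I_n, disjoint_family q &
    forall k, minor a t [set q k j | j in 'I_t]%SET != 0.

Lemma card_lead n t : #|lead n t| = (n - t)%N.
Proof.
by rewrite -sum1dep_card (big_ord_narrow (leq_subr t n)) sum1_card card_ord.
Qed.

Section Base.
Variables (R : realType) (p : nat) (mu : 'F_p -> R).
Hypothesis p_prime : prime p.
Hypothesis mu_ge0 : forall a, 0 <= mu a.
Hypothesis mu_sum1 : \sum_a mu a = 1.
Variable rho : R.
Hypothesis rho_gt0 : 0 < rho.
Hypothesis mu_rho : forall a, mu a <= rho.
Hypothesis rho_lt1 : rho < 1.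

Local Notation sub a := (subper (fun i j => a (i, j))).

Lemma mul_1BX_le m k : rho ^+ m * (1 - rho ^+ k) <= rho ^+ m.
Proof. by rewrite ler_piMr ?exprn_ge0 ?(ltW rho_gt0) // gerBl exprn_ge0 ?(ltW rho_gt0). Qed.

(* First the columns outside [M] are matched to rows, then the other rows to
   columns in [M]. *)
Lemma Pr_no_minor_inside (n T T' : nat) (M : {set 'I_n}) :
  (T + T' <= n)%N -> #|M| = (T + T')%N ->
  (1 - rho) * Pr mu (fun a : {ffun 'I_n * 'I_n -> 'F_p} =>
    ~ exists I : {set 'I_n}, [/\ I \subset M, #|I| = T & minor a T I != 0])
  <= rho ^+ T'.+1 + rho ^+ T.+1.
Proof.
move=> Tn cM; pose W := ~: M; have r1 : 0 <= 1 - rho by rewrite subr_ge0 ltW.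
have cW : #|W| = (n - (T + T'))%N by rewrite cardsCs finset.setCK card_ord cM.
pose A1 (a : {ffun 'I_n * 'I_n -> 'F_p}) := exists A : {set 'I_n},
  [/\ A \subset lead n T, #|A| = #|W| & sub a A W != 0].
have phase1 : (1 - rho) * Pr mu (fun a => ~ A1 a) <= rho ^+ T'.+1.
  pose B1 (a : {ffun 'I_n * 'I_n -> 'F_p}) := exists S' : {set 'I_n},
    [/\ finset.set0 \subset S', S' \subset lead n T,
        #|S'| = (#|@finset.set0 'I_n| + #|W|)%N & sub a (W :|: finset.set0) S' != 0].
  (* Here columns are added to an empty subpermanent, so the greedy extension is applied to the
     transpose; [lead n T] has [T'] more elements than [W]. *)
  have -> : Pr mu (fun a => ~ A1 a) = Pr mu (fun a => ~ B1 a).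
    pose g (z : 'I_n * 'I_n) := (z.2, z.1).
    have gg : bijective g by exists g; case.
    rewrite /Pr -[RHS](Ex_reindex mu _ gg); apply: eq_Ex => a /=; congr (nat_of_bool _)%:R.
    have E A : sub [ffun y => a (g y)] W A = sub a A W.
      by rewrite [RHS]subper_tr; apply: eq_subper => i j _ _; rewrite ffunE.
    apply: asbool_equiv_eq; split=> nA [A].
      move=> [_ AT cA]; rewrite finset.setU0 E => nz; apply: nA; exists A.
      by split=> //; rewrite cA cards0.
    move=> [AT cA nz]; apply: nA; exists A.
    by rewrite finset.setU0 E finset.sub0set cards0; split.
  rewrite mulrC -ler_pdivlMr ?subr_gt0 //.
  apply: (Pr_splice_le_all mu_ge0 mu_sum1 (Z := finset.setX W finset.setT)) => x.
  rewrite ler_pdivlMr ?subr_gt0 // mulrC.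
  apply: le_trans (mul_1BX_le _ #|W|).
  apply: (greedy_extension mu_ge0 mu_sum1 rho_gt0 mu_rho rho_lt1).
  - by rewrite -setI_eq0 finset.setI0.
  - exact: finset.sub0set.
  - exact: finset.subsetT.
  - by rewrite card_lead cards0 cW; clear -Tn; lia.
  - by rewrite subper0 oner_neq0.
pose bad (a : {ffun 'I_n * 'I_n -> 'F_p}) := ~ exists I : {set 'I_n},
  [/\ I \subset M, #|I| = T & minor a T I != 0].
have phase2 : (1 - rho) * Pr mu (fun a => A1 a /\ bad a) <= rho ^+ T.+1.
  have b0 : 0 <= rho ^+ T.+1 / (1 - rho) by rewrite divr_ge0 // exprn_ge0 // ltW.
  rewrite mulrC -ler_pdivlMr ?subr_gt0 //.
  apply: le_trans _ (ler_piMr b0 (Pr_le1 mu_ge0 mu_sum1 A1)).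
  have subW (x y : {ffun 'I_n * 'I_n -> 'F_p}) A :
      sub (splice (finset.setX (lead n T) M) x y) A W = sub x A W.
    apply: eq_subper => i j _; rewrite inE => /negPf jM.
    by rewrite ffunE inE /= jM andbF.
  apply: (Pr_splice_le mu_ge0 mu_sum1 (Z := finset.setX (lead n T) M)).
    by move=> x y [A [AT cA nz]]; exists A; rewrite subW in nz.
  move=> x [A [AT cA nz]].
  (* The rows still unmatched; there are [T'] of them, and [T] columns will remain spare. *)
  pose U := lead n T :\: A.
  have UT : U \subset lead n T by rewrite finset.subsetDl.
  apply: (Pr_splice_le_all mu_ge0 mu_sum1 (Z := finset.setX U M)) => y.
  rewrite ler_pdivlMr ?subr_gt0 // mulrC.
  apply: le_trans (mul_1BX_le _ #|U|).
  have cU : #|U| = T'.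
    by rewrite cardsD (finset.setIidPr AT) card_lead cA cW; clear -Tn; lia.
  pose x1 := splice (finset.setX (lead n T) M) x y.
  have := greedy_extension (e := T) (M := M) (U := U) (A := A) (S := W)
    (D := finset.setT) (x := x1) mu_ge0 mu_sum1 rho_gt0 mu_rho rho_lt1.
  rewrite cU cW => /(_ _ _ _ _ _)le1; apply: le_trans (le1 _ _ _ _ _).
  - rewrite ler_wpM2l //; apply: Pr_le => // y' nI [S' [WS' _ cS' nz']].
    apply: nI; exists (~: S'); split.
    + by rewrite -(finset.setCK M) finset.setCS.
    + by rewrite cardsCs finset.setCK cS' card_ord; clear -Tn; lia.
    rewrite /minor finset.setCK.
    have UA : U :|: A = lead n T.
      by rewrite finset.setUC -{1}(finset.setIidPr AT) finset.setID.
    by move: nz'; rewrite UA splice_splice ?finset.setXS.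
  - by apply/pred0P => i /=; rewrite inE; case: (i \in A); rewrite ?andbF.
  - exact: finset.subsetT.
  - by rewrite finset.setTD finset.setCK.
  - by rewrite cardsT card_ord; clear -Tn; lia.
  - by rewrite subW.
apply: (@le_trans _ _ ((1 - rho) * (Pr mu (fun a => ~ A1 a) + Pr mu (fun a => A1 a /\ bad a)))).
  rewrite ler_wpM2l //; apply: le_trans (Pr_or _ _ _) => //.
  apply: Pr_le => // a ba; have [a1|na1] := pselect (A1 a); first by right.
  by left.
by rewrite mulrDr lerD.
Qed.

Lemma enumerate_set (T : finType) (A : {set T}) (d : nat) : #|A| = d ->
  exists h : 'I_d -> T, injective h /\ [set h j | j in 'I_d]%SET = A.
Proof.
move=> cA; have [h [h_inj hA]] := @injection_of_card T A d (eq_leq (esym cA)).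
exists h; split=> //; apply/eqP; rewrite eqEcard card_imset // card_ord cA leqnn andbT.
by apply/fintype.subsetP => _ /imsetP[j _ ->].
Qed.

Lemma robust_of_pieces (n r t K : nat) (a : {ffun 'I_n * 'I_n -> 'F_p})
    (M : 'I_r -> {set 'I_n}) :
  (forall i i' x, x \in M i -> x \in M i' -> i = i') ->
  (K <= #|[set i | `[< exists I : {set 'I_n},
      [/\ I \subset M i, #|I| = t & (minor a t I != 0)%R] >]]%SET|)%N ->
  robust t K a.
Proof.
move=> Mdis /injection_of_card[f [f_inj fP]].
have /choice[h hP] : forall k, exists h : 'I_t -> 'I_n,
    [/\ injective h, forall j, h j \in M (f k) &
      minor a t [set h j | j in 'I_t]%SET != 0].
  move=> k; have := fP k; rewrite inE => /asboolP[I [IM cI nz]].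
  have [h [h_inj hI]] := enumerate_set cI.
  exists h; split=> //; last by rewrite hI.
  by move=> j; rewrite (fintype.subsetP IM) // -hI imset_f.
exists h => [k j k' j' eq_h|k]; last by have [] := hP k.
have [hI hM _] := hP k; have [_ hM' _] := hP k'.
have kk : k = k'.
  by apply: f_inj; apply: (Mdis _ _ (h k j)) => //; rewrite eq_h.
by move: eq_h; rewrite -kk => /hI ->.
Qed.

(** Among [r] disjoint pieces of [2 * T] columns, each lacks a nonzero minor with probability at
    most [eps / 2], by [Pr_no_minor_inside] with [T' = T]; Markov's inequality leaves at least [K]
    successful pieces. *)
Lemma robust_base (eps : R) : 0 < eps -> exists T0, forall T K, (T0 <= T)%N ->
  exists n0, forall n, (n0 <= n)%N ->
    Pr mu (fun a : {ffun 'I_n * 'I_n -> 'F_p} => ~ robust T K a) <= eps.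
Proof.
move=> eps0; have eps2 : 0 < eps / 2 by rewrite divr_gt0.
have r1 : 0 < 1 - rho by rewrite subr_gt0.
have [||T0 T0P] := @expr_small R rho ((1 - rho) * (eps / 2) / 2).
- by rewrite (ltW rho_gt0).
- by rewrite divr_gt0 // mulr_gt0.
exists T0 => T K TT0.
have [r [r0 rP]] := small_ratio K eps2.
exists #|{: 'I_r * 'I_(T + T)}| => n nr.
have [|f [f_inj _]] := @injection_of_card 'I_n finset.setT #|{: 'I_r * 'I_(T + T)}|.
  by rewrite cardsT card_ord.
pose M i : {set 'I_n} := [set f (enum_rank (i, j)) | j in 'I_(T + T)]%SET.
have cM i : #|M i| = (T + T)%N.
  by rewrite card_imset ?card_ord // => j j' /f_inj/enum_rank_inj[].
have rI : (0 < #|'I_r|)%N by rewrite card_ord.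
pose E i (a : {ffun 'I_n * 'I_n -> 'F_p}) := exists I : {set 'I_n},
  [/\ I \subset M i, #|I| = T & minor a T I != 0].
have bad i : Pr mu (fun a => ~ E i a) <= eps / 2.
  rewrite -(ler_pM2l r1).
  have TTn : (T + T <= n)%N by rewrite -(cM i) -[X in (_ <= X)%N]card_ord max_card.
  apply: le_trans (Pr_no_minor_inside TTn (cM i)) _.
  have rT : rho ^+ T.+1 <= (1 - rho) * (eps / 2) / 2.
    by apply: le_trans T0P; rewrite ler_wiXn2l ?(ltW rho_gt0) ?(ltW rho_lt1) // ltnW.
  by apply: le_trans (lerD rT rT) _; rewrite -splitr.
have := Pr_few mu_ge0 mu_sum1 K bad rI; rewrite card_ord => few.
apply: (@le_trans _ _ (eps / 2 + K%:R / r%:R)); last by rewrite [leRHS]splitr lerD2l.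
apply: le_trans few; apply: Pr_le => // a nrob; rewrite ltnNge; apply/negP => KE.
apply: nrob; apply: robust_of_pieces KE => i i' x.
by move=> /imsetP[j _ ->] /imsetP[j' _ /f_inj/enum_rank_inj[->]].
Qed.

End Base.

(** The minors on pairs of columns form a symmetric matrix with rows and columns indexed by columns;
    a triangle is a triple whose three pairs all have nonzero entries. A pair is encoded by the
    index [j] it omits. *)
Definition triangles (p n K : nat) (a : {ffun 'I_n * 'I_n -> 'F_p}) : Prop :=
  exists2 q : 'I_K -> 'I_3 -> 'I_n, disjoint_family q &
    forall k j, minor a 2 [set q k (lift j i) | i in 'I_2]%SET != 0.

Lemma lead_step n t : (t < n)%N ->
  exists2 r : 'I_n, r \notin lead n t.+1 & lead n t = r |: lead n t.+1.
Proof.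
move=> tn; have rn : (n - t.+1 < n)%N by rewrite ltn_subrL (leq_ltn_trans _ tn).
exists (Ordinal rn); first by rewrite inE ltnn.
apply/setP => i; rewrite !inE -val_eqE /= subnS.
have : (0 < n - t)%N by rewrite subn_gt0.
by case: (n - t)%N => // m _; rewrite ltnS leq_eqVlt.
Qed.

Definition row_coords (n : nat) (r : 'I_n) : {set 'I_n * 'I_n} :=
  finset.setX [set r]%SET finset.setT.

Section Rows.
Variables (p n t : nat) (r : 'I_n).
Hypothesis r_lead : r \notin lead n t.+1.
Hypothesis lead_r : lead n t = r |: lead n t.+1.
Implicit Types (x y : {ffun 'I_n * 'I_n -> 'F_p}).

Lemma minor_splice_lead x y I :
  minor (splice (row_coords r) x y) t.+1 I = minor x t.+1 I.
Proof.
apply: eq_subper => i j ir _; rewrite ffunE !inE andbT.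
by case: eqP => // ri; case/negP: r_lead; rewrite -ri.
Qed.

(** Laplace expansion along the newly exposed row, as a contraction of the tensor of minors at level
    [t.+1]; the 0 covers repeated indices. *)
Lemma minor_splice x y I :
  minor (splice (row_coords r) x y) t I =
  \sum_v y (r, v) * (if v \in I then 0 else minor x t.+1 (v |: I)).
Proof.
rewrite {1}/minor lead_r subper_row // big_mkcond; apply: eq_bigr => v _.
rewrite inE; case: (v \in I) => /=; first by rewrite mulr0.
rewrite ffunE !inE eqxx /= -(minor_splice_lead x y) /minor; congr (_ * subper _ _ _).
by apply/setP => k; rewrite !inE negb_or.
Qed.

End Rows.

(** * Exposing one row: steering conditions *)

Section RowStep.
Variables (R : realType) (p : nat) (mu : 'F_p -> R).
Hypothesis p_prime : prime p.
Hypothesis mu_ge0 : forall a, 0 <= mu a.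
Hypothesis mu_sum1 : \sum_a mu a = 1.
Variables (u v : 'F_p) (kappa : R).
Hypothesis uv : u != v.
Hypothesis kappa_gt0 : 0 < kappa.
Hypothesis mu_u : kappa <= mu u.
Hypothesis mu_v : kappa <= mu v.

Let p_gt0 : 0 < p%:R :> R.
Proof. by rewrite ltr0n prime_gt0. Qed.

Let pV_ge0 : 0 <= p%:R^-1 :> R.
Proof. by rewrite invr_ge0 ltW. Qed.

Let pV_le1 : p%:R^-1 <= 1 :> R.
Proof. by rewrite invf_le1 // ler1n prime_gt0. Qed.

(** The block condition of [hit_many_blocks], for a block with coefficient vectors [g]; [ts] stands
    for the popular vectors and [w] for the other atypical coordinates. *)
Definition steerable (d : nat) (G : pred 'rV['F_p]_d) (gamma : R)
    (g : 'I_d -> 'rV['F_p]_d) : Prop :=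
  forall ts w, uniq ts -> exists a : 'I_d -> 'F_p,
    (forall j, a j = u \/ a j = v) /\
    gamma <= avg ts (fun w => (G w)%:R) (w + \sum_j a j *: g j).

(** The coordinates are all matrix positions; positions outside row [r] receive the coefficient
    vector 0. *)
Lemma row_step (d K : nat) (eps : R) : 0 < eps ->
  exists N, forall (n t : nat) (r : 'I_n) (x : {ffun 'I_n * 'I_n -> 'F_p})
    (q : 'I_N -> 'I_d -> 'I_n) (face : 'I_N -> 'I_d -> {set 'I_n})
    (G : pred 'rV['F_p]_d) (gamma : R),
  r \notin lead n t.+1 -> lead n t = r |: lead n t.+1 ->
  disjoint_family q -> 0 <= gamma <= 1 ->
  (forall k, steerable G gamma (fun j => \row_j'
     if q k j \in face k j' then 0 else minor x t.+1 (q k j |: face k j'))) ->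
  Pr mu (fun y => (#|[set k | G (\row_j
      minor (splice (row_coords r) x y) t (face k j))]%SET| < K)%N) <= 1 - gamma + eps.
Proof.
move=> eps0.
have [N NP] := hit_many_blocks p_prime mu_ge0 mu_sum1 uv kappa_gt0 mu_u mu_v d K eps0.
exists N => n t r x q face G gamma r_lead lead_r q_dis gamma01 steer.
pose L k (z : 'I_n * 'I_n) : 'rV['F_p]_d := if z.1 == r then \row_j
  (if z.2 \in face k j then 0 else minor x t.+1 (z.2 |: face k j)) else 0.
apply: le_trans _ (NP _ (fun k j => (r, q k j)) L G gamma _ gamma01 _); last 2 first.
- by move=> k j k' j' [] /q_dis.
- move=> k ts w uts; have [a [auv aP]] := steer k ts w uts; exists a; split=> //.
  apply: le_trans aP _; rewrite le_eqVlt; apply/orP; left; apply/eqP; congr avg.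
  by congr (_ + _); apply: eq_bigr => j _; rewrite /L eqxx.
apply: Pr_le => // y; congr (_ < _)%N; apply: eq_card => k; rewrite !inE.
congr G; apply/rowP => j; rewrite mxE minor_splice // summxE.
rewrite (bigID (fun z : 'I_n * 'I_n => z.1 == r)) /= [X in _ = _ + X]big1; last first.
  by move=> z zr; rewrite /L (negPf zr) scaler0 mxE.
rewrite addr0 (reindex_onto (fun v : 'I_n => (r, v)) (fun z => z.2)) /=; last first.
  by move=> [i v'] /= /eqP ->.
by apply: eq_big => v'; rewrite ?eqxx // => _; rewrite /L eqxx !mxE.
Qed.

(** If [ts] spans every [g j], it spans the whole space and 0 is hit with probability at most
    [p ^- d]. Otherwise some [g j] is outside the span; changing its coefficient from [u] to [v]
    moves the point to another coset, so one of the two choices avoids 0 altogether. *)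
Lemma steerable_neq0 d (g : 'I_d -> 'rV['F_p]_d) :
  (forall U : {vspace 'rV['F_p]_d}, (forall j, g j \in U) -> U = fullv) ->
  steerable (fun w => w != 0) (1 - p%:R^-1 ^+ d) g.
Proof.
move=> span_g ts w _.
have avgE w' : avg ts (fun w => (w != 0)%:R : R) w' =
    1 - avg ts (fun w => (w == 0)%:R) w'.
  apply: (canRL (addrK _)); rewrite -avgD -[RHS](avg_cst p_prime ts 1 w').
  by apply: eq_avg => z; rewrite -natrD; case: eqP.
have [gts|/existsNP[j gj]] := pselect (forall j, g j \in <<ts>>%VS).
  exists (fun=> u); split; first by left.
  rewrite avgE lerD2l lerN2; apply: le_trans (avg_zero_le _ _ _ _) _ => //.
  by rewrite (span_g _ gts) dimvf dim_matrix mul1r.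
suff [a [auv /avg_zero_notin a0]] : exists a : 'I_d -> 'F_p,
    (forall j, a j = u \/ a j = v) /\ w + \sum_j a j *: g j \notin <<ts>>%VS.
  by exists a; split=> //; rewrite avgE a0 subr0 gerBl exprn_ge0.
pose a1 i := if i == j then v else u.
have [w0|] := boolP (w + \sum_j u *: g j \in <<ts>>%VS); last first.
  by exists (fun=> u); split=> //; left.
exists a1; split; first by move=> i; rewrite /a1; case: eqP; [right|left].
apply/negP => w1; apply: gj.
have : (v - u) *: g j \in <<ts>>%VS.
  have := rpredB w1 w0; rewrite opprD addrACA subrr add0r -sumrB (bigD1 j) //=.
  rewrite /a1 eqxx -scalerBl big1 ?addr0 // => i /negPf ->.
  by rewrite subrr.
move=> /(rpredZ (v - u)^-1); rewrite scalerA mulVf ?scale1r //.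
by rewrite subr_eq0 eq_sym.
Qed.

Lemma span_delta d (U : {vspace 'rV['F_p]_d}) :
  (forall j, delta_mx 0 j \in U) -> U = fullv.
Proof.
move=> dU; apply/eqP; rewrite eqEsubv subvf /=; apply/subvP => w _.
by rewrite [w]row_sum_delta memv_suml // => j _; rewrite rpredZ.
Qed.

Lemma steerable_neq0_diag d (c : 'F_p) : c != 0 ->
  steerable (fun w : 'rV_d => w != 0) (1 - p%:R^-1 ^+ d) (fun j => c *: delta_mx 0 j).
Proof.
move=> c0; apply: steerable_neq0 => U dU; apply: span_delta => j.
by have := rpredZ c^-1 (dU j); rewrite scalerA mulVf // scale1r.
Qed.

(** For each [j], one of [u] and [v] makes coordinate [j] nonzero. From such a point the first bound
    is [avg_all_neq0], the second is [avg_ge_self] with [size ts] at most the number of vectors. *)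
Lemma steerable_all_neq0 d (c : 'F_p) (gamma : R) : c != 0 ->
  gamma <= 1 - d%:R / p%:R \/ gamma <= p%:R^-1 ^+ #|{: 'rV['F_p]_d}| ->
  steerable (fun w : 'rV_d => [forall j, w 0 j != 0]) gamma (fun j => c *: delta_mx 0 j).
Proof.
move=> c0 gammaP ts w uts.
pose a j := if w 0 j + u * c == 0 then v else u.
exists a; split; first by move=> j; rewrite /a; case: eqP; [right|left].
set w' := w + _.
have w'0 j : w' 0 j != 0.
  rewrite !mxE summxE (bigD1 j) //= big1 ?addr0 => [|i ij]; last first.
    by rewrite !mxE eq_sym (negPf ij) andbF !mulr0.
  rewrite !mxE !eqxx mulr1 /a; case: ifP => [/eqP wu|/negbT //].
  apply/eqP => wv; apply: (elimN eqP uv); apply: (mulIf c0).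
  by apply: (addrI (w 0 j)); rewrite wu wv.
case: gammaP => le1; apply: le_trans le1 _; first exact: avg_all_neq0.
apply: le_trans (_ : _ <= p%:R^-1 ^+ size ts * [forall j, w' 0 j != 0]%:R) _.
  have -> : [forall j, w' 0 j != 0] by apply/forallP.
  rewrite mulr1 ler_wiXn2l //; have /card_uniqP <- := uts; exact: max_card.
by apply: avg_ge_self => // z; rewrite ler0n.
Qed.

End RowStep.

Definition facet (n t N : nat) (q : 'I_N -> 'I_t.+1 -> 'I_n) k j : {set 'I_n} :=
  [set q k (lift j i) | i in 'I_t]%SET.

Lemma mem_facet (n t N : nat) (q : 'I_N -> 'I_t.+1 -> 'I_n) k j j' :
  disjoint_family q -> (q k j \in facet q k j') = (j != j').
Proof.
move=> q_dis; apply/imsetP/idP => [[i _ /q_dis[_ ->]]|].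
  by rewrite eq_sym neq_lift.
by case: (unliftP j' j) => [i -> _|->]; [exists i|rewrite eqxx].
Qed.

Lemma facetU (n t N : nat) (q : 'I_N -> 'I_t.+1 -> 'I_n) k j :
  q k j |: facet q k j = [set q k i | i in 'I_t.+1]%SET.
Proof.
apply/setP => z; rewrite !inE; apply/orP/imsetP => [[/eqP ->|/imsetP[i _ ->]]|[i _ ->]].
- by exists j.
- by exists (lift j i).
- case: (unliftP j i) => [i' ->|->]; last by left.
  by right; apply: imset_f.
Qed.

(** * Descent from level t+1 to level t *)

Section Chain.
Variables (R : realType) (p : nat) (mu : 'F_p -> R).
Hypothesis p_prime : prime p.
Hypothesis mu_ge0 : forall a, 0 <= mu a.
Hypothesis mu_sum1 : \sum_a mu a = 1.
Variables (u v : 'F_p) (kappa : R).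
Hypothesis uv : u != v.
Hypothesis kappa_gt0 : 0 < kappa.
Hypothesis mu_u : kappa <= mu u.
Hypothesis mu_v : kappa <= mu v.

(** For [j' != j], [q k j] is a repeated index in facet [j'], so on a block the coefficient matrix
    of the contraction is scalar, with the full minor on the diagonal. *)
Lemma facet_row (n t N : nat) (x : {ffun 'I_n * 'I_n -> 'F_p})
    (q : 'I_N -> 'I_t.+1 -> 'I_n) k j : disjoint_family q ->
  (\row_j' if q k j \in facet q k j' then 0
     else minor x t.+1 (q k j |: facet q k j')) =
  minor x t.+1 [set q k i | i in 'I_t.+1]%SET *: delta_mx 0 j :> 'rV['F_p]_t.+1.
Proof.
move=> q_dis; apply/rowP => j'; rewrite !mxE mem_facet // eqxx /= eq_sym.
by case: eqVneq => [->|_] /=; rewrite ?mulr0 // mulr1 facetU.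
Qed.

Let pV01 d : 0 <= 1 - (p%:R^-1 : R) ^+ d <= 1.
Proof.
have p1 : 1 <= p%:R :> R by rewrite ler1n prime_gt0.
have pV0 : 0 <= p%:R^-1 :> R by rewrite invr_ge0 (le_trans ler01).
by rewrite subr_ge0 exprn_ile1 ?invf_le1 ?(lt_le_trans ltr01) // gerBl exprn_ge0.
Qed.

Lemma Pr_next_row (n t : nat) (A B : {ffun 'I_n * 'I_n -> 'F_p} -> Prop) (b : R) :
  (forall r x, r \notin lead n t.+1 -> lead n t = r |: lead n t.+1 ->
    forall y, A (splice (row_coords r) x y) -> A x) ->
  (forall r x, r \notin lead n t.+1 -> lead n t = r |: lead n t.+1 ->
    A x -> Pr mu (fun y => ~ B (splice (row_coords r) x y)) <= b) ->
  (t < n)%N -> (1 - b) * Pr mu A <= Pr mu (fun x => A x /\ B x).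
Proof.
move=> AA AB /lead_step[r r_lead lead_r].
apply: (Pr_splice_ge mu_ge0 mu_sum1 (Z := row_coords r)).
- by move=> x y; apply: (AA r x).
- by move=> x; apply: (AB r x).
Qed.

Lemma robust_unspliced (n t K : nat) r (x y : {ffun 'I_n * 'I_n -> 'F_p}) :
  r \notin lead n t.+1 -> robust t.+1 K (splice (row_coords r) x y) -> robust t.+1 K x.
Proof.
move=> r_lead [q q_dis q_nz]; exists q => // k.
by rewrite -(minor_splice_lead r_lead x y).
Qed.

(** The event [C], determined by the earlier rows, is the absence of triangles in
    [likely_robust1]. *)
Lemma robust_step (t K : nat) (eps : R) : 0 < eps ->
  exists N, forall n (C : {ffun 'I_n * 'I_n -> 'F_p} -> Prop),
    (forall r x y, r \notin lead n t.+1 -> C (splice (row_coords r) x y) -> C x) ->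
    (t < n)%N ->
    (1 - (p%:R^-1 ^+ t.+1 + eps)) * Pr mu (fun a => robust t.+1 N a /\ C a) <=
    Pr mu (fun a => (robust t.+1 N a /\ C a) /\ robust t K a).
Proof.
move=> eps0.
have [N NP] := row_step p_prime mu_ge0 mu_sum1 uv kappa_gt0 mu_u mu_v t.+1 K eps0.
exists N => n C CC; apply: Pr_next_row => r x r_lead lead_r.
  by move=> y [rob Cy]; split; [apply: robust_unspliced rob|apply: CC Cy].
move=> [[q q_dis q_nz] _].
have le1 := NP n t r x q (facet q) (fun w => w != 0) _ r_lead lead_r q_dis (pV01 t.+1).
apply: le_trans _ (le_trans (le1 _) _); last by rewrite opprB addrCA subrr addr0.
- apply: Pr_le => // y nrob; rewrite ltnNge; apply/negP => /injection_of_card[f [f_inj fP]].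
  apply: nrob.
  have /choice[j jP] : forall k, exists j, minor (splice (row_coords r) x y) t (facet q (f k) j) != 0.
    move=> k; have := fP k; rewrite inE => /rV0Pn[j]; rewrite mxE => nz.
    by exists j.
  exists (fun k i => q (f k) (lift (j k) i)) => [k i k' i' /q_dis[/f_inj kk]|//].
  by rewrite kk => /lift_inj.
- move=> k ts w uts.
  have [a [auv aP]] := steerable_neq0_diag R p_prime uv (q_nz k) w uts.
  exists a; split=> //; apply: le_trans aP _.
  rewrite le_eqVlt; apply/orP; left; apply/eqP; congr avg; congr (_ + _).
  by apply: eq_bigr => j _; rewrite facet_row.
Qed.

(* The second bound on [gamma] is needed for [p = 3], where [1 - 3 / p = 0]. *)
Lemma triangles_step (K : nat) (gamma eps : R) : 0 < eps -> 0 <= gamma <= 1 ->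
  gamma <= 1 - 3%:R / p%:R \/ gamma <= p%:R^-1 ^+ #|{: 'rV['F_p]_3}| ->
  exists N, forall n, (2 < n)%N ->
    (gamma - eps) * Pr mu (fun a : {ffun 'I_n * 'I_n -> 'F_p} => robust 3 N a) <=
    Pr mu (fun a : {ffun 'I_n * 'I_n -> 'F_p} => triangles K a).
Proof.
move=> eps0 gamma01 gammaP.
have [N NP] := row_step p_prime mu_ge0 mu_sum1 uv kappa_gt0 mu_u mu_v 3 K eps0.
exists N => n n2.
apply: (@le_trans _ _ (Pr mu (fun a : {ffun 'I_n * 'I_n -> 'F_p} =>
    robust 3 N a /\ triangles K a))); last by apply: Pr_le => // a [].
have -> : gamma - eps = 1 - (1 - gamma + eps) by rewrite opprD opprB addrA addrCA subrr addr0.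
move: n2; apply: Pr_next_row => r x r_lead lead_r.
  by move=> y; apply: robust_unspliced.
move=> [q q_dis q_nz].
have le1 := NP n 2 r x q (facet q) (fun w => [forall j, w 0 j != 0]) _ r_lead lead_r q_dis gamma01.
apply: le_trans _ (le1 _).
- apply: Pr_le => // y ntri; rewrite ltnNge; apply/negP => /injection_of_card[f [f_inj fP]].
  apply: ntri; exists (fun k i => q (f k) i) => [k i k' i' /q_dis[/f_inj -> ->]//|k j].
  by have := fP k; rewrite inE => /forallP/(_ j); rewrite mxE.
- move=> k ts w uts.
  have [a [auv aP]] := steerable_all_neq0 p_prime uv (q_nz k) gammaP w uts.
  exists a; split=> //; apply: le_trans aP _.
  rewrite le_eqVlt; apply/orP; left; apply/eqP; congr avg; congr (_ + _).
  by apply: eq_bigr => j _; rewrite facet_row.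
Qed.

End Chain.

Lemma pair_facet (n N : nat) (q : 'I_N -> 'I_3 -> 'I_n) k (i j : 'I_3) : i != j ->
  exists l, facet q k l = q k i |: [set q k j]%SET.
Proof.
rewrite -val_eqE /= => ij; have [i3 j3] := (ltn_ord i, ltn_ord j).
(* As [0 + 1 + 2 = 3], the third index is [3 - i - j]. *)
have l3 : (3 - i - j < 3)%N by lia.
have [l lE] : exists l : 'I_3, (l : nat) = (3 - i - j)%N by exists (Ordinal l3).
exists l; apply/setP => z; rewrite !inE; apply/imsetP/orP.
  move=> [m _ ->]; have := neq_lift l m; move: (lift _ m) => w.
  rewrite -val_eqE /= => lw; have w3 := ltn_ord w.
  have [->|] := eqVneq w i; first by left.
  rewrite -val_eqE /= => wi; right; apply/eqP; congr (q k _); apply: val_inj => /=.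
  by lia.
move=> [/eqP ->|/eqP ->].
  case: (unliftP l i) => [i' ->|il]; first by exists i'.
  by have /= := congr1 val il; lia.
case: (unliftP l j) => [j' ->|jl]; first by exists j'.
by have /= := congr1 val jl; lia.
Qed.

(* For a symmetric matrix with zero diagonal and nonzero off-diagonal entries,
   [2 * M i j * M i l] times the [i]-th unit vector is
   [- M j l * row i + M i l * row j + M i j * row l]. *)
Lemma span_triangle (F : fieldType) (g : 'I_3 -> 'rV[F]_3) (U : {vspace 'rV[F]_3}) :
  2%:R != 0 :> F -> (forall i, g i 0 i = 0) -> (forall i j, g i 0 j = g j 0 i) ->
  (forall i j, i != j -> g i 0 j != 0) -> (forall i, g i \in U) ->
  forall i, delta_mx 0 i \in U.
Proof.
move=> two gd gs gn gU i; pose j := lift i ord0; pose l := lift i (ord_max : 'I_2).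
have ij : i != j by rewrite neq_lift.
have il : i != l by rewrite neq_lift.
have c0 : 2%:R * g i 0 j * g i 0 l != 0 by rewrite !mulf_neq0 ?gn.
have : - g j 0 l *: g i + g i 0 l *: g j + g i 0 j *: g l \in U.
  by rewrite !rpredD ?rpredZ.
move=> /(rpredZ (2%:R * g i 0 j * g i 0 l)^-1).
congr (_ \in U); apply/rowP => m; rewrite !mxE eqxx /=.
have [->|mi] := eqVneq m i.
  by rewrite gd (gs j i) (gs l i) /=; field; rewrite !gn //= ?two.
have mjl : m = j \/ m = l.
  case: (unliftP i m) mi => [m' ->|->]; last by rewrite eqxx.
  by move=> _; case: (unliftP ord0 m') => [m'' ->|->]; [right|left];
     congr lift; apply: val_inj; rewrite /= ?ord1.
by case: mjl => ->; rewrite gd ?(gs l j) ?mulr0n; ring.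
Qed.

(** * Descent from triangles, and the last row *)

Section Chain2.
Variables (R : realType) (p : nat) (mu : 'F_p -> R).
Hypothesis p_prime : prime p.
Hypothesis p_ge3 : (3 <= p)%N.
Hypothesis mu_ge0 : forall a, 0 <= mu a.
Hypothesis mu_sum1 : \sum_a mu a = 1.
Variables (u v : 'F_p) (kappa : R).
Hypothesis uv : u != v.
Hypothesis kappa_gt0 : 0 < kappa.
Hypothesis mu_u : kappa <= mu u.
Hypothesis mu_v : kappa <= mu v.

Lemma Fp_two_neq0 : 2%:R != 0 :> 'F_p.
Proof.
rewrite -(dvdn_pcharf (pchar_Fp p_prime)); apply/negP => dvd_p2; have := dvdn_leq (isT : (0 < 2)%N) dvd_p2.
by rewrite leqNgt p_ge3.
Qed.

(** The faces are the single indices of a triple. The coefficient matrix on the triple is symmetric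
    with zero diagonal and nonzero entries elsewhere, hence of full rank by [span_triangle]; this
    gives the exponent 3 instead of 2. *)
Lemma robust1_of_triangles (K : nat) (eps : R) : 0 < eps ->
  exists N, forall n, (1 < n)%N ->
    (1 - (p%:R^-1 ^+ 3 + eps)) *
      Pr mu (fun a : {ffun 'I_n * 'I_n -> 'F_p} => triangles N a) <=
    Pr mu (fun a : {ffun 'I_n * 'I_n -> 'F_p} => triangles N a /\ robust 1 K a).
Proof.
move=> eps0.
have [N NP] := row_step p_prime mu_ge0 mu_sum1 uv kappa_gt0 mu_u mu_v 3 K eps0.
exists N => n; apply: (Pr_next_row mu_ge0 mu_sum1) => r x r_lead lead_r.
  move=> y [q q_dis q_nz]; exists q => // k j.
  by rewrite -(minor_splice_lead r_lead x y).
move=> [q q_dis q_nz].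
have g01 : 0 <= 1 - (p%:R^-1 : R) ^+ 3 <= 1.
  have p1 : 1 <= p%:R :> R by rewrite ler1n prime_gt0.
  have pV0 : 0 <= p%:R^-1 :> R by rewrite invr_ge0 (le_trans ler01).
  by rewrite subr_ge0 exprn_ile1 ?invf_le1 ?(lt_le_trans ltr01) // gerBl exprn_ge0.
have le1 := NP n 1 r x q (fun k j => [set q k j]%SET) (fun w => w != 0) _ r_lead lead_r q_dis g01.
apply: le_trans _ (le_trans (le1 _) _); last by rewrite opprB addrCA subrr addr0.
- apply: Pr_le => // y nrob; rewrite ltnNge; apply/negP => /injection_of_card[f [f_inj fP]].
  apply: nrob.
  have /choice[j jP] : forall k, exists j,
      minor (splice (row_coords r) x y) 1 [set q (f k) j]%SET != 0.
    move=> k; have := fP k; rewrite inE => /rV0Pn[j]; rewrite mxE => nz.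
    by exists j.
  exists (fun k _ => q (f k) (j k)) => [k i k' i' /q_dis[/f_inj -> _]|k].
    by rewrite !ord1.
  have -> // : [set q (f k) (j k) | _ in 'I_1]%SET = [set q (f k) (j k)]%SET.
  apply/setP => z; rewrite !inE; apply/imsetP/eqP => [[]//|->].
  by exists ord0.
- move=> k; apply: steerable_neq0 => // U gU; apply: span_delta.
  apply: (span_triangle Fp_two_neq0 _ _ _ gU) => [i|i j|i j ij].
  + by rewrite mxE inE eqxx.
  + rewrite !mxE !inE eq_sym; case: ifP => // _.
    by congr (minor x 2 _); apply/setP => z; rewrite !inE orbC.
  + rewrite mxE inE; case: ifP => [/eqP/q_dis[_ eq_ij]|_].
      by rewrite eq_ij eqxx in ij.
    by have [l <-] := pair_facet q k ij; apply: q_nz.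
Qed.

(** Among more than [p * s] nonzero coefficients some value [tau] occurs more than [s] times, and
    the sum of the corresponding entries is nearly uniform. *)
Lemma last_row (eta : R) : 0 < eta ->
  exists N, forall n (z : 'F_p), (0 < n)%N ->
    (1 - eta) / p%:R * Pr mu (fun a : {ffun 'I_n * 'I_n -> 'F_p} => robust 1 N a) <=
    Pr mu (fun a : {ffun 'I_n * 'I_n -> 'F_p} => minor a 0 finset.set0 = z).
Proof.
move=> eta0.
have [s sP] := conv_equidistributed p_prime mu_ge0 mu_sum1 uv kappa_gt0 mu_u mu_v eta0.
exists (p * s).+1 => n z n0.
apply: (@le_trans _ _ (Pr mu (fun a : {ffun 'I_n * 'I_n -> 'F_p} =>
    robust 1 (p * s).+1 a /\ minor a 0 finset.set0 = z))); last by apply: Pr_le => // a [].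
rewrite -[(1 - eta) / _](subKr 1).
move: n0; apply: (Pr_next_row mu_ge0 mu_sum1) => r x r_lead lead_r.
  by move=> y; apply: robust_unspliced.
move=> [q q_dis q_nz]; pose c k := minor x 1 [set q k j | j in 'I_1]%SET.
have [tau tauP] : exists tau, (s < #|[set k | c k == tau]%SET|)%N.
  apply: contrapT => /forallNP none; have : ((p * s).+1 <= p * s)%N; last by rewrite ltnn.
  rewrite -[X in (X <= _)%N]card_ord -sum1_card (partition_big c xpredT) //=.
  apply: (@leq_trans (\sum_(t : 'F_p) s)); last by rewrite sum_nat_const card_Fp.
  by apply: leq_sum => t _; rewrite sum1dep_card leqNgt; apply/negP.
have tau0 : tau != 0.
  have /card_gt0P[k] := leq_ltn_trans (leq0n s) tauP.
  by rewrite inE => /eqP <-; apply: q_nz.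
pose V0 := [set q k ord0 | k in [set k | c k == tau]]%SET.
pose W := [set (r, i) | i in V0]%SET.
have cW : (s <= #|W|)%N.
  have pair_inj : injective (fun i : 'I_n => (r, i)) by move=> i j [].
  have q0_inj : injective (fun k => q k ord0) by move=> k k' /q_dis[].
  by rewrite (card_imset _ pair_inj) (card_imset _ q0_inj) ltnW.
rewrite (Pr_not mu_sum1) lerD2l lerN2 {1}/Pr (Ex_splice mu_sum1 W).
rewrite -[leLHS](Ex_cst mu_sum1 ('I_n * 'I_n)%type); apply: Ex_le => // y.
pose c' (i : 'I_n) := if i \in (@finset.set0 'I_n) then 0 else minor x 1 (i |: finset.set0).
have c'E i : i \in V0 -> c' i = tau.
  move=> /imsetP[k]; rewrite inE => /eqP <- ->; rewrite /c' inE /c; congr (minor x 1 _).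
  apply/setP => w; rewrite !inE orbF; apply/eqP/imsetP => [->|[j _ ->]]; first by exists ord0.
  by rewrite (ord1 j).
(* The contribution of the remaining entries; the permanent is [z] exactly when the sum over [W] is
   [(z - C) / tau]. *)
pose C := \sum_(i | i \notin V0) y (r, i) * c' i.
apply: le_trans (sP #|W| ((z - C) / tau) cW) _.
apply: (@le_trans _ _ (\sum_a conv mu #|W| a * (a * tau + C == z)%:R)).
  rewrite (bigD1 ((z - C) / tau)) //= divfK // subrK eqxx mulr1 lerDl.
  by apply: sumr_ge0 => a _; rewrite mulr_ge0 ?conv_ge0.
rewrite -(Ex_sum_coord mu_sum1 W (fun a => (a * tau + C == z)%:R)).
rewrite le_eqVlt; apply/orP; left; apply/eqP; apply: eq_Ex => y'.
congr (nat_of_bool _)%:R; rewrite (minor_splice r_lead lead_r).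
have -> : \sum_i splice W y y' (r, i) * c' i = (\sum_(w in W) y' w) * tau + C.
  rewrite (bigID (mem V0)) /=; congr (_ + _).
    rewrite [X in _ = X * tau]big_imset /= => [|i j _ _ [] //]; rewrite mulr_suml.
    by apply: eq_bigr => i iV0; rewrite c'E // ffunE imset_f.
  apply: eq_bigr => i iV0; rewrite ffunE; case: ifP => // /imsetP[j jV0 [ij]].
  by rewrite ij jV0 in iV0.
by apply/eqP/asboolP.
Qed.

End Chain2.

(** * Asymptotic frequencies *)

Section Asymptotics.
Variables (R : realType) (p : nat) (mu : 'F_p -> R).
Hypothesis p_prime : prime p.
Hypothesis p_ge3 : (3 <= p)%N.
Hypothesis mu_ge0 : forall a, 0 <= mu a.
Hypothesis mu_sum1 : \sum_a mu a = 1.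
Variables (u v : 'F_p) (kappa : R).
Hypothesis uv : u != v.
Hypothesis kappa_gt0 : 0 < kappa.
Hypothesis mu_u : kappa <= mu u.
Hypothesis mu_v : kappa <= mu v.
Local Notation x := (p%:R^-1 : R).

(** A lower bound [beta] for the limit inferior of the probabilities. *)
Definition eventually_likely (E : forall n, {ffun 'I_n * 'I_n -> 'F_p} -> Prop)
    (beta : R) : Prop :=
  forall eps, 0 < eps -> exists n0, forall n, (n0 <= n)%N -> beta - eps <= Pr mu (@E n).

Definition likely_robust t beta :=
  forall K, eventually_likely (fun n => @robust p n t K) beta.

Definition likely_triangles beta :=
  forall K, eventually_likely (fun n => @triangles p n K) beta.

Lemma invp_gt0 : 0 < x.
Proof. by rewrite invr_gt0 ltr0n prime_gt0. Qed.

Lemma invp_le : x <= 3%:R^-1.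
Proof. by rewrite lef_pV2 ?posrE ?ltr0n ?prime_gt0 // ler_nat. Qed.

Lemma invp_expr01 d : 0 <= x ^+ d <= 1.
Proof.
rewrite exprn_ge0 ?(ltW invp_gt0) //= exprn_ile1 ?(ltW invp_gt0) //.
by apply: le_trans invp_le _; rewrite invf_le1 ?ltr0n // ler1n.
Qed.

Lemma step_arith (P e s beta : R) : 0 <= P <= 1 -> 0 < e -> s <= 1 ->
  beta - e / 2 <= s -> beta * P - e <= (P - e / 2) * s.
Proof.
move=> /andP[P0 P1] e0 s1 sb.
have h1 := ler_wpM2l P0 sb; have h2 := ler_wpM2l (ltW e0) P1.
have h3 := ler_wpM2l (ltW e0) s1.
lra.
Qed.

Lemma likely_robust_step t beta :
  likely_robust t.+1 beta -> likely_robust t (beta * (1 - x ^+ t.+1)).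
Proof.
move=> lik K eps eps0; have eps2 : 0 < eps / 2 by rewrite divr_gt0.
have [N NP] := robust_step p_prime mu_ge0 mu_sum1 uv kappa_gt0 mu_u mu_v t K eps2.
have [n0 n0P] := lik N _ eps2.
exists (maxn n0 t.+1) => n; rewrite geq_max => /andP[/n0P le1 tn].
have le2 := NP n (fun=> True) (fun _ _ _ _ _ => I) tn.
have sE : Pr mu (fun a => @robust p n t.+1 N a /\ True) = Pr mu (@robust p n t.+1 N).
  by apply: eq_Pr => // a; split=> [[]|].
apply: le_trans (_ : _ <= (1 - x ^+ t.+1 - eps / 2) * Pr mu (@robust p n t.+1 N)) _.
  apply: step_arith => //; last exact: Pr_le1.
  have /andP[x0 x1] := invp_expr01 t.+1.
  by rewrite subr_ge0 x1 gerBl x0.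
rewrite sE opprD addrA in le2; apply: le_trans le2 _.
by apply: Pr_le => // a [].
Qed.

Lemma likely_triangles_of_robust beta gamma : 0 <= gamma <= 1 ->
  gamma <= 1 - 3%:R * x \/ gamma <= x ^+ #|{: 'rV['F_p]_3}| ->
  likely_robust 3 beta -> likely_triangles (beta * gamma).
Proof.
move=> gamma01 gammaP lik K eps eps0; have eps2 : 0 < eps / 2 by rewrite divr_gt0.
have [N NP] := triangles_step p_prime mu_ge0 mu_sum1 uv kappa_gt0 mu_u mu_v K eps2 gamma01 gammaP.
have [n0 n0P] := lik N _ eps2.
exists (maxn n0 3) => n; rewrite geq_max => /andP[/n0P le1 tn].
apply: le_trans (NP n tn); apply: step_arith => //; exact: Pr_le1.
Qed.

Definition tail_prod t T : R := \prod_(t.+1 <= i < T.+1) (1 - x ^+ i).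

Lemma likely_robust_iter t k beta :
  likely_robust (t + k) beta -> likely_robust t (beta * tail_prod t (t + k)).
Proof.
elim: k beta => [|k IH] beta lik.
  by rewrite addn0 /tail_prod big_geq // mulr1; rewrite addn0 in lik.
rewrite addnS in lik *; rewrite /tail_prod big_nat_recr /=; last first.
  by rewrite ltnS leq_addr.
rewrite [_ * (1 - _)]mulrC mulrA; apply: IH; exact: likely_robust_step.
Qed.

(** The summand [x ^+ (t + k) / 2] carries the induction; the step uses [3 * x <= 1]. *)
Lemma tail_prod_ge t k : 1 - x ^+ t / 2 + x ^+ (t + k) / 2 <= tail_prod t (t + k).
Proof.
elim: k => [|k IH].
  by rewrite addn0 /tail_prod big_geq // subrK.
rewrite addnS /tail_prod big_nat_recr /=; last by rewrite ltnS leq_addr.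
have x0 := invp_gt0; have xle := invp_le.
have /andP[y0 _] := invp_expr01 (t + k); have /andP[_ y1] := invp_expr01 (t + k).+1.
have ya : x ^+ (t + k) <= x ^+ t.
  by rewrite ler_wiXn2l ?leq_addr ?(ltW x0) //; have /andP[] := invp_expr01 1; rewrite expr1.
apply: le_trans (ler_wpM2r _ IH); last by rewrite subr_ge0.
rewrite exprS; move: x x0 xle (x ^+ (t + k)) y0 (x ^+ t) ya => z z0 zle y y0 a ya.
have h1 := mulr_ge0 y0 (ltW z0); have h2 := mulr_ge0 h1 (etrans (subr_ge0 _ _) ya).
have h3 := ler_wpM2l y0 zle.
lra.
Qed.

(** Robustness starts at a high level with probability close to 1 and descends to [t]; a common
    lower bound [q] of the finite products plays the role of the infinite product. *)
Lemma likely_robust_lim (rho : R) t q : 0 < rho -> (forall a, mu a <= rho) -> rho < 1 ->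
  (forall k, q <= tail_prod t (t + k)) -> likely_robust t q.
Proof.
move=> rho0 mu_rho rho1 qle K eps eps0; have eps2 : 0 < eps / 2 by rewrite divr_gt0.
have [T0 T0P] := robust_base mu_ge0 mu_sum1 rho0 mu_rho rho1 eps2.
have lik : likely_robust (t + T0) (1 - eps / 2).
  move=> K' e e0; have [n0 n0P] := T0P (t + T0)%N K' (leq_addl _ _).
  exists n0 => n /n0P; rewrite (Pr_not mu_sum1) => le1.
  rewrite lerBlDr; apply: (@le_trans _ _ (Pr mu (@robust p n (t + T0) K'))).
    by rewrite lerBlDr addrC -lerBlDr.
  by rewrite lerDl ltW.
have [n0 n0P] := likely_robust_iter lik K eps2.
exists n0 => n /n0P; apply: le_trans; move: (qle T0).
have : tail_prod t (t + T0) <= 1.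
  apply: prodr_ile1 => i _; have /andP[x0 x1] := invp_expr01 i.
  by rewrite subr_ge0 x1 gerBl x0.
move: (tail_prod _ _) => pr pr1 qpr; have := ler_wpM2l (ltW eps2) pr1.
lra.
Qed.

Lemma combine_arith (P2 d e X s2 s3 b2 b3 : R) :
  0 <= P2 <= 1 -> 0 <= d <= 1 -> 0 < e -> 0 <= X <= 1 -> 0 <= s3 <= 1 ->
  b2 - e / 4 <= s2 -> b3 - e / 4 <= s3 -> s2 - s3 <= X ->
  b2 * P2 + b3 * d - e <= (P2 - e / 4) * X + (P2 + d - e / 4) * s3.
Proof.
move=> /andP[P0 P1] /andP[d0 d1] e0 /andP[X0 X1] /andP[s0 s1] b2s b3s sX.
have h1 := ler_wpM2l P0 sX; have h2 := ler_wpM2l P0 b2s.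
have h3 := ler_wpM2l d0 b3s; have h4 := ler_wpM2l (ltW e0) P1.
have h5 := ler_wpM2l (ltW e0) d1; have h6 := ler_wpM2l (ltW e0) X1.
have h7 := ler_wpM2l (ltW e0) s1.
lra.
Qed.

(** Cases without triangles survive the row with factor [1 - x ^+ 2], those with triangles with
    factor [1 - x ^+ 3]; the difference of the factors is the gain on the frequency [b3]. *)
Lemma likely_robust1 b2 b3 : likely_robust 2 b2 -> likely_triangles b3 ->
  likely_robust 1 (b2 * (1 - x ^+ 2) + b3 * (x ^+ 2 - x ^+ 3)).
Proof.
move=> lik2 lik3 K eps eps0; have eps4 : 0 < eps / 4%:R by rewrite divr_gt0.
have [N2 N2P] := robust_step p_prime mu_ge0 mu_sum1 uv kappa_gt0 mu_u mu_v 1 K eps4.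
have [N3 N3P] := robust1_of_triangles p_prime p_ge3 mu_ge0 mu_sum1 uv kappa_gt0 mu_u mu_v K eps4.
have [n2 n2P] := lik2 N2 _ eps4; have [n3 n3P] := lik3 N3 _ eps4.
exists (maxn 2 (maxn n2 n3)) => n; rewrite !geq_max => /and3P[n1 /n2P le2 /n3P le3].
have ntri r (a b : {ffun 'I_n * 'I_n -> 'F_p}) : r \notin lead n 2 ->
    ~ triangles N3 (splice (row_coords r) a b) -> ~ triangles N3 a.
  move=> r_lead nt [q q_dis q_nz]; apply: nt; exists q => // k j.
  by rewrite (minor_splice_lead r_lead).
have step2 := N2P n (fun a => ~ triangles N3 a) ntri n1.
have step3 := N3P n n1.
pose X := Pr mu (fun a => @robust p n 2 N2 a /\ ~ triangles N3 a).
have sX : Pr mu (@robust p n 2 N2) - Pr mu (@triangles p n N3) <= X.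
  rewrite (Pr_split _ _ (@triangles p n N3)) lerBlDr addrC lerD2l.
  by apply: Pr_le => // a [].
apply: le_trans (_ : _ <= (1 - x ^+ 2 - eps / 4%:R) * X +
    (1 - x ^+ 2 + (x ^+ 2 - x ^+ 3) - eps / 4%:R) * Pr mu (@triangles p n N3)) _.
  apply: combine_arith le2 le3 sX => //; rewrite ?Pr_ge0 ?Pr_le1 //.
    by have /andP[x0 x1] := invp_expr01 2; rewrite subr_ge0 x1 gerBl x0.
  have /andP[x0 x1] := invp_expr01 2; have /andP[y0 y1] := invp_expr01 3.
  rewrite subr_ge0 lerBlDr; apply/andP; split; last by rewrite (le_trans x1) // lerDl.
  by have /andP[z0 z1] := invp_expr01 1; rewrite expr1 in z0 z1; rewrite ler_wiXn2l.
rewrite (Pr_split _ (@robust p n 1 K) (@triangles p n N3)) addrC; apply: lerD.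
  rewrite opprD addrA in step3; rewrite addrA subrK.
  by apply: le_trans step3 _; apply: Pr_le => // a [].
rewrite opprD addrA in step2; apply: le_trans step2 _.
by apply: Pr_le => // a [[]].
Qed.

Lemma lead0 n : lead n 0 = finset.setT.
Proof. by apply/setP => i; rewrite !inE subn0 ltn_ord. Qed.

Lemma minor0 n (a : {ffun 'I_n * 'I_n -> 'F_p}) :
  minor a 0 finset.set0 = permanent (\matrix_(i, j) a (i, j)).
Proof.
rewrite permanent_subper /minor lead0 finset.setC0.
by apply: eq_subper => i j _ _; rewrite mxE.
Qed.

Lemma final_arith (y e s b : R) : 0 <= y <= 1 -> 0 < e < 1 -> 0 <= s <= 1 ->
  b - e / 2 <= s -> y * b - e <= (1 - e / 2) * y * s.
Proof.
move=> /andP[y0 y1] /andP[e0 e1] /andP[s0 s1] bs.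
have h1 := ler_wpM2l y0 bs; have h2 := ler_wpM2l (ltW e0) y1.
have h3 := ler_wpM2l (ltW e0) (ler_pM y0 s0 y1 s1).
lra.
Qed.

(** The last row bounds every value from below; the upper bound for [z] follows by subtracting the
    lower bounds for the other [p - 1] values from 1. *)
Lemma permanent_near_uniform b1 (eps : R) : likely_robust 1 b1 -> 0 < eps < 1 ->
  exists n0, forall n z, (n0 <= n)%N ->
    x * b1 - eps <=
      Pr mu (fun a : {ffun 'I_n * 'I_n -> 'F_p} => permanent (\matrix_(i, j) a (i, j)) = z)
    <= 1 - (1 - x) * b1 + eps.
Proof.
move=> lik eps01; have /andP[eps0 eps1] := eps01.
have eps2 : 0 < eps / 2 by rewrite divr_gt0.
have [N NP] := last_row p_prime mu_ge0 mu_sum1 uv kappa_gt0 mu_u mu_v eps2.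
have [n0 n0P] := lik N _ eps2.
exists (maxn n0 1) => n z; rewrite geq_max => /andP[/n0P le1 n1].
set s := Pr mu _ in le1.
have s01 : 0 <= s <= 1 by rewrite Pr_ge0 ?Pr_le1.
pose f z := Pr mu (fun a : {ffun 'I_n * 'I_n -> 'F_p} =>
  permanent (\matrix_(i, j) a (i, j)) = z).
have fE z' : (1 - eps / 2) * x * s <= f z'.
  apply: le_trans (NP n z' n1) _; apply: Pr_le => // a <-.
  by rewrite minor0.
have x01 := invp_expr01 1; rewrite expr1 in x01.
apply/andP; split; first by apply: le_trans (fE z); apply: final_arith.
have f1 : \sum_z f z = 1.
  rewrite -Ex_sum -[RHS](Ex_cst mu_sum1 ('I_n * 'I_n)%type); apply: eq_Ex => a.
  rewrite (bigD1 (permanent (\matrix_(i, j) a (i, j)))) //= asboolT // big1 ?addr0 //.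
  by move=> z' /eqP nz; rewrite asboolF // => eqz; apply: nz.
have fz : f z = 1 - \sum_(z' | z' != z) f z' by rewrite -f1 (bigD1 z) //= addrK.
rewrite -/(f z) fz -addrA lerD2l lerNl opprD opprK.
apply: le_trans (_ : _ <= (1 - eps / 2) * (1 - x) * s) _.
  apply: final_arith => //; have /andP[x0 x1] := x01.
  by rewrite subr_ge0 x1 gerBl x0.
apply: (@le_trans _ _ (\sum_(z' : 'F_p | z' != z) (1 - eps / 2) * x * s)); last exact: ler_sum.
rewrite sumr_const (_ : #|_| = p.-1); last first.
  by have := cardC1 z; rewrite card_Fp // => <-; apply: eq_card => w; rewrite !inE.
have xp : p%:R * x = 1 by rewrite divff // pnatr_eq0 -lt0n prime_gt0.
have pE : p.-1%:R = p%:R - 1 :> R by rewrite -subn1 natrB // prime_gt0.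
rewrite -[leRHS]mulr_natl pE (_ : _ * _ * s = (1 - eps / 2) * s * (p%:R * x - x)); last by rewrite xp; ring.
by rewrite le_eqVlt; apply/orP; left; apply/eqP; ring.
Qed.

End Asymptotics.

(** * Transfer from the random matrix to the product measure *)

Lemma permanent_law (R : realType) (p : nat) (d : measure_display)
    (T : measurableType d) (P : probability T R) (n : nat) (mu : 'F_p -> R)
    (A : T -> 'M['F_p]_n) (z : 'F_p) :
  iid_random_matrix P mu A ->
  P [set w | permanent (A w) = z]%classic =
  (Pr mu (fun a : {ffun 'I_n * 'I_n -> 'F_p} =>
            permanent (\matrix_(i, j) a (i, j)) = z))%:E.
Proof.
case=> mA distA indA.
pose E (k : 'I_n * 'I_n) w := A w k.1 k.2.
pose F (a : {ffun 'I_n * 'I_n -> 'F_p}) : set T :=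
  (\bigcap_(k in [set` [set: 'I_n * 'I_n]%SET]) (E k @^-1` [set a k]))%classic.
have FE a w : F a w <-> forall k, E k w = a k.
  by split=> [Fw k|Ew k _]; [apply: Fw; rewrite /= inE|apply: Ew].
have PF a : P (F a) = (weight mu a)%:E.
  rewrite /F indA /weight -prodEFin; apply: eq_big => [k|k _]; first by rewrite inE.
  exact: distA.
pose D : set {ffun 'I_n * 'I_n -> 'F_p} :=
  [set a | permanent (\matrix_(i, j) a (i, j)) = z]%classic.
have -> : [set w | permanent (A w) = z]%classic = (\bigcup_(a in D) F a)%classic.
  apply/seteqP; split=> w /=.
    move=> Aw; exists [ffun k => E k w]; last by apply/FE => k; rewrite ffunE.
    rewrite /D /= -Aw; congr permanent; apply/matrixP => i j.
    by rewrite mxE ffunE.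
  move=> [a Da /FE Ea]; rewrite -Da; congr permanent; apply/matrixP => i j.
  by rewrite mxE -Ea.
rewrite measure_fin_bigcup; last 3 first.
- exact: finite_finset.
- move=> a b _ _ [w [/FE Ea /FE Eb]]; apply/ffunP => k.
  by rewrite -Ea -Eb.
- move=> a _; apply: fin_bigcap_measurable => [|k _]; first exact: finite_finset.
  exact: mA.
rewrite (fsbigE [seq a <- enum {: {ffun 'I_n * 'I_n -> 'F_p}} | a \in D]).
- rewrite /Pr /Ex -sumEFin big_filter_cond big_enum_cond /= big_mkcond /=.
  apply: eq_bigr => a _; rewrite PF andbb; have [Da|Da] := pselect (D a).
    by rewrite mem_set // asboolT // mulr1.
  by rewrite memNset // asboolF // mulr0.
- by rewrite filter_uniq // enum_uniq.
- by move=> a /=; rewrite mem_filter => /andP[/set_mem].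
- by move=> a Da; rewrite mem_filter mem_set // mem_enum.
Qed.

Lemma limn_esup_le_eventually (R : realType) (w : nat -> \bar R) (c : \bar R) n0 :
  (forall n, (n0 <= n)%N -> (w n <= c)%E) -> (limn_esup w <= c)%E.
Proof.
move=> wc; apply: le_trans (_ : _ <= ereal_sup (w @` [set n | (n0 <= n)%N])%classic)%E _.
  apply: ereal_inf_lbound; exists [set n | (n0 <= n)%N]%classic => //.
  by exists n0.
by apply: ge_ereal_sup => _ [n /= n0n <-]; apply: wc.
Qed.

Lemma limn_einf_ge_eventually (R : realType) (w : nat -> \bar R) (c : \bar R) n0 :
  (forall n, (n0 <= n)%N -> (c <= w n)%E) -> (c <= limn_einf w)%E.
Proof.
move=> wc; rewrite /limn_einf leeNr.
by apply: (limn_esup_le_eventually (n0 := n0)) => n /wc; rewrite leeN2.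
Qed.

(** * The constants of the two bounds *)

Section Constants.
Variables (R : realType) (p : nat).
Hypothesis p_prime : prime p.
Hypothesis p_ge3 : (3 <= p)%N.
Local Notation x := (p%:R^-1 : R).

Lemma alpha_le k : 1 - alpha R p <= (1 - x) * (1 - x ^+ 2) * tail_prod R p 2 (2 + k).
Proof.
pose w n : R := \prod_(1 <= i < n.+1) (1 - p%:R ^- i).
have f01 i : 0 <= 1 - (p%:R : R) ^- i <= 1.
  have /andP[x0 x1] := invp_expr01 R p_prime p_ge3 i.
  by rewrite -exprVn subr_ge0 x1 gerBl x0.
have w0 n : 0 <= w n by apply: prodr_ge0 => i _; have /andP[] := f01 i.
have wdecr : nonincreasing_seq w.
  apply/nonincreasing_seqP => n; rewrite /w big_nat_recr //= ler_piMr //.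
  exact: w0.
have wcvg : cvgn w.
  apply: nonincreasing_is_cvgn => //; exists 0 => _ [n _ <-]; exact: w0.
rewrite /alpha subKr; apply: le_trans (nonincreasing_cvgn_ge wdecr wcvg (2 + k)) _.
rewrite /w /tail_prod big_ltn; last by [].
rewrite big_ltn; last by rewrite !ltnS.
rewrite mulrA expr1 -exprVn; under eq_bigr do rewrite -exprVn.
exact: lexx.
Qed.

(** A crude frequency, the robustness bound at level 3 times the second option of [triangles_step];
    it is positive also for [p = 3]. *)
Definition triangle_freq : R := (1 - x ^+ 3 / 2) * x ^+ #|{: 'rV['F_p]_3}|.

(** The amount by which triangles lower the bound [1 - (1 - x) * b1] of [permanent_near_uniform]
    below [alpha]. *)
Definition gain : R := (1 - x) * (triangle_freq * (x ^+ 2 - x ^+ 3)).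

Lemma gain_gt0 : 0 < gain.
Proof.
have x0 := invp_gt0 R p_prime; have x3 := invp_le R p_prime p_ge3.
have x1 : 0 < 1 - x by move: x x0 x3 => y y0 y3; lra.
have /andP[y0 y1] := invp_expr01 R p_prime p_ge3 3.
rewrite /gain /triangle_freq !mulr_gt0 ?exprn_gt0 //.
  by move: (x ^+ 3) y0 y1 => y y0 y1; lra.
by rewrite [x ^+ 3]exprS -[X in X - _]mul1r -mulrBl mulr_gt0 ?exprn_gt0.
Qed.

(** The terms of order [y ^+ 2] cancel, since at that order the triangles recover the whole loss.
    What remains is about [1 - 11/2 * y ^+ 3], whence the constant 6. *)
Lemma near_one_arith (y : R) : 0 < y -> y <= 3%:R^-1 ->
  1 - 6%:R * y ^+ 3 <= (1 - y ^+ 3 / 2) * (1 - y ^+ 3) * (1 - y ^+ 2) +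
    (1 - y ^+ 3 / 2) * (1 - 3%:R * y) * (y ^+ 2 - y ^+ 3).
Proof.
move=> y0 y3; set z := y ^+ 3.
have z0 : 0 <= z by rewrite exprn_ge0 // ltW.
have z1 : z <= 9%:R^-1.
  have y9 : y * y <= 3%:R^-1 * 3%:R^-1 by rewrite ler_pM // ltW.
  have : y * y * y <= 3%:R^-1 * 3%:R^-1 * 3%:R^-1 by rewrite ler_pM // ?mulr_ge0 // ltW.
  rewrite /z !exprS expr0; lra.
have -> : (1 - z / 2) * (1 - z) * (1 - y ^+ 2) + (1 - z / 2) * (1 - 3%:R * y) * (y ^+ 2 - z) =
    (1 - z / 2) * (1 - 5%:R * z + z * (y ^+ 2 + 3%:R * y)) by rewrite /z; ring.
have w0 : 0 <= z * (y ^+ 2 + 3%:R * y).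
  by rewrite mulr_ge0 // addr_ge0 ?exprn_ge0 ?mulr_ge0 ?(ltW y0).
apply: le_trans (_ : _ <= (1 - z / 2) * (1 - 5%:R * z)) _.
  have := mulr_ge0 z0 z0; lra.
by rewrite ler_wpM2l ?lerDl //; lra.
Qed.

End Constants.

(** * Bounds for all large n *)

Section Distribution.
Variables (R : realType) (p : nat) (mu : 'F_p -> R).
Hypothesis p_prime : prime p.
Hypothesis p_ge3 : (3 <= p)%N.
Hypothesis mu_dist : is_distribution mu.
Hypothesis mu_two : exists a b : 'F_p, [/\ a <> b, mu a <> 0 & mu b <> 0].
Local Notation x := (p%:R^-1 : R).

Lemma permanent_law_bounds :
  exists n0, forall n z, (n0 <= n)%N ->
    let pr := Pr mu (fun a : {ffun 'I_n * 'I_n -> 'F_p} =>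
      permanent (\matrix_(i, j) a (i, j)) = z) in
    pr <= alpha R p - gain R p / 2 /\
    x - 7%:R * x ^+ 3 <= pr <= x + 7%:R * x ^+ 3.
Proof.
have [mu_ge0 mu_sum1] := mu_dist; have [u [v [uv mu0 mv0]]] := mu_two.
pose kappa := Num.min (mu u) (mu v).
have muu : 0 < mu u by rewrite lt_def mu_ge0 andbT; apply/eqP.
have muv : 0 < mu v by rewrite lt_def mu_ge0 andbT; apply/eqP.
have k0 : 0 < kappa by rewrite lt_min muu.
have ku : kappa <= mu u by rewrite ge_min lexx.
have kv : kappa <= mu v by rewrite ge_min lexx orbT.
have pair_le a b : a != b -> mu a + mu b <= 1.
  move=> ab; rewrite -mu_sum1 (bigD1 a) //= lerD2l (bigD1 b) //=; last by rewrite eq_sym.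
  by rewrite lerDl sumr_ge0.
have uv' : u != v by apply/eqP.
(* Every value leaves out [u] or [v], whose mass is at least [kappa]. *)
pose rho := 1 - kappa.
have rho_lt1 : rho < 1 by rewrite ltrBlDr ltrDl.
have mu_rho a : mu a <= rho.
  rewrite lerBrDr; have [->|au] := eqVneq a u.
    by apply: le_trans (pair_le _ _ uv'); rewrite lerD2l.
  by apply: le_trans (pair_le _ _ au); rewrite lerD2l.
have rho_gt0 : 0 < rho by apply: lt_le_trans muu (mu_rho u).
have x0 := invp_gt0 R p_prime; have x3 := invp_le R p_prime p_ge3.
have xX := invp_expr01 R p_prime p_ge3.
have robust_lim := likely_robust_lim p_prime p_ge3 mu_ge0 mu_sum1 uv' k0 ku kv rho_gt0 mu_rho rho_lt1.
have rob3 : likely_robust mu 3 (1 - x ^+ 3 / 2).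
  apply: robust_lim => k; apply: le_trans (tail_prod_ge R p_prime p_ge3 3 k).
  by rewrite lerDl divr_ge0 //; have /andP[] := xX (3 + k)%N.
have gA : 0 < gain R p := gain_gt0 R p_prime p_ge3.
(* Half of the gain is spent on the error term; the other half remains as [delta]. *)
pose e := Num.min (gain R p / 2) (1 / 2).
have e01 : 0 < e < 1.
  apply/andP; split; first by rewrite lt_min !divr_gt0.
  by rewrite gt_min; apply/orP; right; rewrite ltr_pdivrMr // mul1r ltr1n.
have x1 : 0 < 1 - x by move: x x0 x3 => y y0 y3; lra.
have x21 : 0 < 1 - x ^+ 2.
  rewrite subr_gt0 expr2; move: x x0 x3 => y y0 y3.
  by apply: le_lt_trans (_ : 3%:R^-1 * 3%:R^-1 < 1); [rewrite ler_pM // ltW|lra].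
(* The quotient is the infinite product of [1 - x ^+ i] over [i >= 3]. *)
have rob2 : likely_robust mu 2 ((1 - alpha R p) / ((1 - x) * (1 - x ^+ 2))).
  apply: robust_lim => k; rewrite ler_pdivrMr ?mulr_gt0 // mulrC.
  exact: alpha_le.
have triA : likely_triangles mu (triangle_freq R p).
  apply: (likely_triangles_of_robust p_prime mu_ge0 mu_sum1 uv' k0 ku kv _ _ rob3).
    exact: xX.
  by right.
have [nA nAP] := permanent_near_uniform p_prime p_ge3 mu_ge0 mu_sum1 uv' k0 ku kv
  (likely_robust1 p_prime p_ge3 mu_ge0 mu_sum1 uv' k0 ku kv rob2 triA) e01.
(* For the bounds around [1 / p], explicit frequencies replace [alpha] and the crude triangle
   count. *)
have rob2B : likely_robust mu 2 ((1 - x ^+ 3 / 2) * (1 - x ^+ 3)).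
  exact: (likely_robust_step p_prime p_ge3 mu_ge0 mu_sum1 uv' k0 ku kv).
have triB : likely_triangles mu ((1 - x ^+ 3 / 2) * (1 - 3%:R * x)).
  apply: (likely_triangles_of_robust p_prime mu_ge0 mu_sum1 uv' k0 ku kv _ _ rob3).
    by move: x x0 x3 => y y0 y3; apply/andP; split; lra.
  by left.
have x301 : 0 < x ^+ 3 < 1.
  rewrite exprn_gt0 //= exprn_ilt1 ?(ltW x0) //.
  by move: x x0 x3 => y y0 y3; lra.
(* The error [x ^+ 3] turns the constant 6 of [near_one_arith] into 7. *)
have [nB nBP] := permanent_near_uniform p_prime p_ge3 mu_ge0 mu_sum1 uv' k0 ku kv
  (likely_robust1 p_prime p_ge3 mu_ge0 mu_sum1 uv' k0 ku kv rob2B triB) x301.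
exists (maxn nA nB) => n z; rewrite geq_max => /andP[nAn nBn] pr; split.
  have /andP[_] := nAP n z nAn; rewrite -/pr => /le_trans; apply.
  have -> : 1 - (1 - x) * ((1 - alpha R p) / ((1 - x) * (1 - x ^+ 2)) * (1 - x ^+ 2)
      + triangle_freq R p * (x ^+ 2 - x ^+ 3)) = alpha R p - gain R p.
    rewrite /gain; move: (triangle_freq _ _) (alpha _ _) (x ^+ 2 - x ^+ 3) => tf al c.
    move: (1 - x) (1 - x ^+ 2) x1 x21 => a b a0 b0.
    by field; rewrite (gt_eqF a0) (gt_eqF b0).
  have : e <= gain R p / 2 by rewrite ge_min lexx.
  by move: (e) (gain R p) (alpha R p) => e' g al; lra.
have := nBP n z nBn; rewrite -/pr => /andP[le1 le2].
have := near_one_arith x0 x3; set b1 := (X in _ <= X) => b1ge.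
have /andP[z0 z1] := x301.
move: le1 le2; rewrite -/b1 => le1 le2.
have xy : x * (1 - 6%:R * x ^+ 3) <= x * b1 by rewrite ler_wpM2l // ltW.
have xy' : (1 - x) * (1 - 6%:R * x ^+ 3) <= (1 - x) * b1 by rewrite ler_wpM2l // ltW.
have x4 : x * x ^+ 3 <= x ^+ 3 by rewrite ler_piMl ?(ltW z0) // -subr_ge0 ltW.
have x40 : 0 <= x * x ^+ 3 by rewrite mulr_ge0 ?(ltW x0) // ltW.
apply/andP; split.
  apply: le_trans le1; apply: le_trans _ (lerB xy (lexx (x ^+ 3))).
  by move: (x ^+ 3) x4 => y3; move: x => y y4; lra.
apply: le_trans le2 _; apply: le_trans (lerD (lerB (lexx 1) xy') (lexx (x ^+ 3))) _.
by move: (x ^+ 3) x40 => y3; move: x => y y4; lra.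
Qed.

End Distribution.

Unset Implicit Arguments.
Local Open Scope classical_set_scope.
Local Open Scope ring_scope.

Theorem theorem1p4 (R : realType) :
  exists C : R, 0 < C /\
  forall p : nat, prime p -> (3 <= p)%N ->
  exists delta : R, 0 < delta /\
  forall mu : 'F_p -> R, is_distribution mu ->
  (exists a b : 'F_p, [/\ a <> b, mu a <> 0 & mu b <> 0]) ->
  forall (d : nat -> measure_display) (T : forall n, measurableType (d n))
         (P : forall n, probability (T n) R)
         (A : forall n, T n -> 'M['F_p]_n),
  (forall n, iid_random_matrix (P n) mu (A n)) ->
  forall z : 'F_p,
  let Pr (n : nat) : \bar R := P n [set w | permanent (A n w) = z] in
  (limn_esup Pr <= (alpha R p - delta)%:E)%E /\
  [/\ ((p%:R^-1 - C / p%:R ^+ 3)%:E <= limn_einf Pr)%E,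
      (limn_einf Pr <= limn_esup Pr)%E
    & (limn_esup Pr <= (p%:R^-1 + C / p%:R ^+ 3)%:E)%E].
Proof.
exists 7%:R; split=> // p p_prime p_ge3.
exists (gain R p / 2); split; first by rewrite divr_gt0 ?gain_gt0.
move=> mu mu_dist mu_two d T P A iidA z pr.
have [n0 n0P] := permanent_law_bounds p_prime p_ge3 mu_dist mu_two.
have prE n := permanent_law z (iidA n).
split.
  apply: (limn_esup_le_eventually (n0 := n0)) => n /(n0P n z)[le1 _].
  by rewrite /pr prE lee_fin.
rewrite -exprVn; split; last 1 first.
- apply: (limn_esup_le_eventually (n0 := n0)) => n /(n0P n z)[_ /andP[_ le2]].
  by rewrite /pr prE lee_fin.
- apply: (limn_einf_ge_eventually (n0 := n0)) => n /(n0P n z)[_ /andP[le1 _]].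
  by rewrite /pr prE lee_fin.
- exact: limn_einf_sup.
Qed.
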